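(* Let $\hat x:\mathrm{M}^2\to\mathbb{S}^3$ be an immersed surface in the conformal sphere $\mathbb{S}^3$ with no umbilical point, and let $x^+$ be its associate ruled 3-surface in the hyperboloid $\mathbb{H}^4$. Then $\hat x$ is a Willmore surface in the conformal sphere if and only if $x^+$ is a minimal surface in the hyperboloid $\mathbb{H}^4$.
   Context: $\mathbb{R}^{1,4}=\{(t,x):t\in\mathbb{R},x\in\mathbb{R}^4\}$ with $\langle(t,x),(s,y)\rangle=-st+x\cdot y$; $\mathbb{N}^4_+=\{(t,x):-t^2+|x|^2=0,\ t>0\}$; $\mathbb{S}^{1,3}=\{(t,x):-t^2+|x|^2=1\}$; $\mathbb{H}^4=\{(t,x):-t^2+|x|^2=-1,\ t>0\}$ with the induced (hyperbolic) metric. $\mathbb{S}^3\subset\mathbb{R}^4$ is the unit sphere with round metric. All maps are smooth. For an immersed surface $\hat x:\mathrm{M}^2\to\mathbb{S}^3\subset\mathbb{R}^4$ with unit normal ${\bf n}$ (tangent to $\mathbb{S}^3$) and local isothermal coordinates $(u^1,u^2)$: $I=\langle d\hat x,d\hat x\rangle$, $II=-\langle d\hat x,d{\bf n}\rangle$, $H=\frac12\mathrm{tr}_I II$, $\overset{\circ}{II}=II-HI$; a point is umbilical if $\overset{\circ}{II}=0$ there. $\hat x$ is a Willmore surface if $\Delta H+|\overset{\circ}{II}|^2H=0$, with $\Delta$ and the norm taken with respect to $I$ (a conformally invariant condition). The conformal Gauss map is $\xi=Hy+(0,{\bf n}):\mathrm{M}^2\to\mathbb{S}^{1,3}$, where $y=(1,\hat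 x)$. When $\hat x$ has no umbilical point, $\xi$ is a spacelike immersion and there is a unique $y^*:\mathrm{M}^2\to\mathbb{N}^4_+$ with $\langle y^*,y\rangle=-1$, $\langle y^*,y^*\rangle=0$, $\langle y^*,\xi\rangle=0$, $\langle y^*,\xi_{u^1}\rangle=\langle y^*,\xi_{u^2}\rangle=0$. The associate ruled 3-surface of $\hat x$ is $$x^+=\frac1{\sqrt2}(e^ty+e^{-t}y^* ):\mathbb{R}\times\mathrm{M}^2\to\mathbb{H}^4,\qquad t\in\mathbb{R}.$$ $\xi$ is a unit normal to $x^+$ in $\mathbb{H}^4$. The fundamental forms are $I^{x^+}=\langle dx^+,dx^+\rangle$ and $II^{x^+}=-\langle dx^+,d\xi\rangle$, the mean curvature is $H^{x^+}=\mathrm{Tr}\big((I^{x^+})^{-1}II^{x^+}\big)$, and $x^+$ is minimal if $H^{x^+}$ vanishes identically wherever $I^{x^+}$ is nondegenerate. *)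

(* Defs.v *)
From HB Require Import structures.
From mathcomp Require Import all_boot all_order all_algebra.
From mathcomp Require Import all_classical all_reals all_analysis.
Import Order.TTheory GRing.Theory Num.Theory.
Import numFieldNormedType.Exports.

Set Implicit Arguments.
Unset Strict Implicit.
Unset Printing Implicit Defensive.

Local Open Scope classical_set_scope.
Local Open Scope ring_scope.

Section SmoothMaps.
Context {R : realType} {m : nat} {W : normedModType R}.

Definition pderiv (i : 'I_m) (F : 'rV[R]_m -> W) : 'rV[R]_m -> W :=
  fun u => 'D_(delta_mx 0 i) F u.

(* Class C^k on V; only used for open V, where no one-sided derivative can
   occur. *)
Fixpoint Ck_on (k : nat) (V : set 'rV[R]_m) (F : 'rV[R]_m -> W) : Prop :=
  if k is k'.+1 then
    (forall u, V u -> differentiable F u) /\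
    (forall i, Ck_on k' V (pderiv i F))
  else forall u, V u -> {for u, continuous F}.

Definition smooth_on (V : set 'rV[R]_m) (F : 'rV[R]_m -> W) : Prop :=
  forall k, Ck_on k V F.

End SmoothMaps.

(* A homeomorphism between an open subset of M and an open subset of R^2. The
   functions coord and param are total, but only their values on cdom and cimg
   are meaningful. *)
Record chart (R : realType) (M : topologicalType) := Chart {
  cdom : set M;
  cimg : set 'rV[R]_2;
  coord : M -> 'rV[R]_2;
  param : 'rV[R]_2 -> M;
  cdom_open : open cdom;
  cimg_open : open cimg;
  coord_cimg : forall p, cdom p -> cimg (coord p);
  param_cdom : forall u, cimg u -> cdom (param u);
  coordK : forall p, cdom p -> param (coord p) = p;
  paramK : forall u, cimg u -> coord (param u) = u;
  coord_continuous : {within cdom, continuous coord};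
  param_continuous : {within cimg, continuous param} }.

(* The preferred chart at a point only serves to evaluate quantities that do
   not depend on the chart. *)
Record smooth_atlas (R : realType) (M : topologicalType) := SmoothAtlas {
  charts : set (chart R M);
  chart_at : M -> chart R M;
  chart_at_charts : forall p, charts (chart_at p);
  chart_at_cdom : forall p, cdom (chart_at p) p;
  transition_smooth : forall c c', charts c -> charts c' ->
    smooth_on (cimg c `&` param c @^-1` cdom c') (coord c' \o param c) }.

Section Minkowski.
Context {R : realType}.

Definition dot {m : nat} (v w : 'rV[R]_m) : R := (v *m w^T) 0 0.

(* The first coordinate is the time coordinate. *)
Definition mink (v w : 'rV[R]_(1 + 4)) : R :=
  - (lsubmx v 0 0 * lsubmx w 0 0) + dot (rsubmx v) (rsubmx w).

Definition lightcone4 : set 'rV[R]_(1 + 4) :=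
  [set v | mink v v = 0 /\ 0 < lsubmx v 0 0].

Definition deSitter3 : set 'rV[R]_(1 + 4) := [set v | mink v v = 1].

Definition hyperboloid4 : set 'rV[R]_(1 + 4) :=
  [set v | mink v v = -1 /\ 0 < lsubmx v 0 0].

Definition sphere3 : set 'rV[R]_4 := [set v | dot v v = 1].

End Minkowski.

Section Surfaces.
Context {R : realType} {M : topologicalType} (A : smooth_atlas R M).

Definition smooth_map {W : normedModType R} (f : M -> W) : Prop :=
  forall c, charts A c -> smooth_on (cimg c) (f \o param c).

Definition immersed_in_S3 (x : M -> 'rV[R]_4) : Prop :=
  [/\ smooth_map x,
      forall p, sphere3 (x p)
    & forall c u, charts A c -> cimg c u -> injective ('d (x \o param c) u)].

Definition unit_normal (x n : M -> 'rV[R]_4) : Prop :=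
  [/\ smooth_map n,
      forall p, dot (n p) (n p) = 1,
      forall p, dot (n p) (x p) = 0
    & forall c u i, charts A c -> cimg c u ->
        dot (n (param c u)) (pderiv i (x \o param c) u) = 0].

Section Invariants.
Context (x n : M -> 'rV[R]_4).

Definition first_form (c : chart R M) (u : 'rV[R]_2) : 'M[R]_2 :=
  \matrix_(i, j) dot (pderiv i (x \o param c) u) (pderiv j (x \o param c) u).

Definition second_form (c : chart R M) (u : 'rV[R]_2) : 'M[R]_2 :=
  \matrix_(i, j) - dot (pderiv i (x \o param c) u) (pderiv j (n \o param c) u).

Definition mean_curvature (p : M) : R :=
  let c := chart_at A p in
  let u := coord c p in
  2^-1 * \tr (invmx (first_form c u) *m second_form c u).

Definition tracefree_second_form (c : chart R M) (u : 'rV[R]_2) : 'M[R]_2 :=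
  second_form c u - mean_curvature (param c u) *: first_form c u.

Definition umbilical (p : M) : Prop :=
  exists c, [/\ charts A c, cdom c p & tracefree_second_form c (coord c p) = 0].

(* The squared norm g^{ik} g^{jl} T_ij T_kl of a symmetric 2-tensor T with
   respect to the metric g. *)
Definition tensor_normsq (g T : 'M[R]_2) : R :=
  \tr (invmx g *m T *m invmx g *m T).

(* The Laplace-Beltrami operator of the first fundamental form; in isothermal
   coordinates, where I = e^{2w} (du1^2 + du2^2), it is
   e^{-2w} (f_{u1u1} + f_{u2u2}). *)
Definition laplacian (f : M -> R) (c : chart R M) (u : 'rV[R]_2) : R :=
  let vol v := Num.sqrt (\det (first_form c v)) in
  (vol u)^-1 *
  \sum_i pderiv i (fun v => vol v *
    \sum_j invmx (first_form c v) i j * pderiv j (f \o param c) v) u.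

Definition willmore : Prop :=
  forall c u, charts A c -> cimg c u ->
    laplacian mean_curvature c u
    + tensor_normsq (first_form c u) (tracefree_second_form c u)
      * mean_curvature (param c u) = 0.

Definition light_lift (p : M) : 'rV[R]_(1 + 4) := row_mx 1%:M (x p).

Definition conformal_gauss (p : M) : 'rV[R]_(1 + 4) :=
  mean_curvature p *: light_lift p + row_mx 0 (n p).

(* ys is the map y^*. *)
Definition dual_light_lift (ys : M -> 'rV[R]_(1 + 4)) : Prop :=
  [/\ smooth_map ys,
      forall p, lightcone4 (ys p),
      forall p, mink (ys p) (light_lift p) = -1,
      forall p, mink (ys p) (conformal_gauss p) = 0
    & forall c u i, charts A c -> cimg c u ->
        mink (ys (param c u)) (pderiv i (conformal_gauss \o param c) u) = 0].

Definition ruled_surface (ys : M -> 'rV[R]_(1 + 4)) (tp : R * M) :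
    'rV[R]_(1 + 4) :=
  (Num.sqrt 2)^-1 *: (expR tp.1 *: light_lift tp.2 + expR (- tp.1) *: ys tp.2).

End Invariants.

(* The coordinates on R x M induced by a chart of M: the first one is t. *)
Definition prod_param (c : chart R M) (w : 'rV[R]_(1 + 2)) : R * M :=
  (lsubmx w 0 0, param c (rsubmx w)).

Section ThreeSurfaces.
Context (f nu : R * M -> 'rV[R]_(1 + 4)).

Definition first_form3 (c : chart R M) (w : 'rV[R]_(1 + 2)) : 'M[R]_(1 + 2) :=
  \matrix_(a, b) mink (pderiv a (f \o prod_param c) w)
                      (pderiv b (f \o prod_param c) w).

Definition second_form3 (c : chart R M) (w : 'rV[R]_(1 + 2)) : 'M[R]_(1 + 2) :=
  \matrix_(a, b) - mink (pderiv a (f \o prod_param c) w)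
                        (pderiv b (nu \o prod_param c) w).

(* The map f : R x M -> H^4 with unit normal field nu has vanishing mean
   curvature wherever its first fundamental form is nondegenerate. *)
Definition minimal3 : Prop :=
  forall c w, charts A c -> cimg c (rsubmx w) ->
    first_form3 c w \in unitmx ->
    \tr (invmx (first_form3 c w) *m second_form3 c w) = 0.

End ThreeSurfaces.

End Surfaces.

Section Targets.
Context {R : realType} {M : topologicalType} (A : smooth_atlas R M).
Context (x n : M -> 'rV[R]_4) (x_S3 : forall p, sphere3 (x p)).

Lemma dotDl k (u v w : 'rV[R]_k) : dot (u + v) w = dot u w + dot v w.
Proof. by rewrite /dot mulmxDl mxE. Qed.

Lemma dotZl k a (u w : 'rV[R]_k) : dot (a *: u) w = a * dot u w.
Proof. by rewrite /dot -scalemxAl mxE. Qed.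

Lemma dotC k (u w : 'rV[R]_k) : dot u w = dot w u.
Proof. by rewrite /dot -[in LHS](trmxK u) -trmx_mul mxE. Qed.

Lemma minkC u w : mink u w = mink w u :> R.
Proof. by rewrite /mink dotC mulrC. Qed.

Lemma minkDl u v w : mink (u + v) w = mink u w + mink v w :> R.
Proof. by rewrite /mink !linearD/= dotDl !mxE mulrDl opprD addrACA. Qed.

Lemma minkZl a u w : mink (a *: u) w = a * mink u w :> R.
Proof.
have ZR : rsubmx (a *: u) = a *: rsubmx u by apply/rowP => i; rewrite !mxE.
by rewrite /mink ZR dotZl !mxE mulrDr mulrN mulrA.
Qed.

Lemma mink_row a b (v w : 'rV[R]_4) :
  mink (row_mx a v) (row_mx b w) = - (a 0 0 * b 0 0) + dot v w.
Proof. by rewrite /mink !row_mxKl !row_mxKr. Qed.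

Lemma light_lift_lightcone p : lightcone4 (light_lift x p).
Proof.
split; last by rewrite row_mxKl mxE ltr01.
by rewrite mink_row x_S3 mxE mulr1 addNr.
Qed.

Lemma conformal_gauss_deSitter p :
  unit_normal A x n -> deSitter3 (conformal_gauss A x n p).
Proof.
case=> _ n1 nx _; rewrite /deSitter3/= /conformal_gauss.
set h := mean_curvature _ _ _ _; set y := light_lift x p.
set e := row_mx 0 (n p).
have yy : mink y y = 0 by case: (light_lift_lightcone p).
have ee : mink e e = 1 by rewrite mink_row n1 mxE mul0r oppr0 add0r.
have ey : mink e y = 0 by rewrite mink_row nx mxE mul0r oppr0 add0r.
rewrite minkDl minkZl !(minkC _ (_ + _)) !minkDl !minkZl yy ee ey.
by rewrite (minkC y) ey !mulr0 !add0r mulr0 add0r.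
Qed.

Lemma ruled_surface_hyperboloid ys tp :
  dual_light_lift A x n ys -> hyperboloid4 (ruled_surface x ys tp).
Proof.
case: tp => t p [_ lys ysy _ _]; rewrite /ruled_surface/=.
case: (lys p) => ysys yst; case: (light_lift_lightcone p) => yy yt.
set y := light_lift x p in yy yt ysy *.
split; last first.
  rewrite linearZ linearD !linearZ/= !mxE mulr_gt0 ?invr_gt0 ?sqrtr_gt0//.
  by rewrite addr_gt0// mulr_gt0 ?expR_gt0//; move: yt yst; rewrite !mxE.
rewrite minkZl minkC minkZl minkDl !minkZl !(minkC _ (_ + _)) !minkDl !minkZl.
rewrite yy ysys (minkC y) ysy !mulr0 add0r addr0 mulrA -invfM -expr2.
rewrite sqr_sqrtr// !mulrN1 !mulrN -!expRD addNr subrr expR0.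
by rewrite -opprD mulrN mulVf// pnatr_eq0.
Qed.

End Targets.

(* Main.v *)
Require Import Defs.
From HB Require Import structures.
From mathcomp Require Import all_boot all_order all_algebra.
From mathcomp Require Import all_classical all_reals all_analysis.
From mathcomp Require Import ring lra.
Import Order.TTheory GRing.Theory Num.Theory.
Import numFieldNormedType.Exports.
Local Open Scope classical_set_scope.
Local Open Scope ring_scope.

Set Implicit Arguments.
Unset Strict Implicit.
Unset Printing Implicit Defensive.

(* Write y* = (1 + s.x, s) with s in R^4.  Orthogonality of y* to the conformal Gauss
   map xi and to its derivatives says H = s.n and H_j = s.(H x_j + n_j).
   Differentiating the latter expresses the Laplacian of H through y*, and the
   Codazzi equations turn the Willmore expression Delta H + |II0|^2 H into the trace
   g^{ij} B_ij of B_ij = <d_i y*, d_j xi>.  On the other side let P_ij be the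
   components of d_i y* along the projections of the d_j y orthogonal to y and y*, and
   put C = e^t + e^{-t} P g^{-1}.  After the splitting of the t-direction, the first
   form of x^+ is (1/2) C g C^T, its second form is C II0 / sqrt 2, and
   B = - P g^{-1} II0.  Since II0 is trace-free and C is a 2x2 matrix, the mean
   curvature of x^+ is (sqrt 2 e^{-t} / det C) g^{ij} B_ij, and det C <> 0 for large
   t. *)

(** Charts are arbitrary, and [mean_curvature] is read off in a preferred chart that changes from
    point to point. Its formula is transported to a fixed chart by invariance of the trace under
    congruence, while its regularity comes from y*: the relations H = s.n and H_j = s.(H x_j + n_j)
    hold on the whole chart, so each differentiation of H costs only one of s, x, n. Vectors are
    expanded in the frame x, n, x_1, x_2 of R^4, which turns every geometric identity into a
    rational identity between inner products, without Christoffel symbols. The Willmore side works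
    because Z_j = H x_j + n_j is minus II0, with one index raised, applied to the coordinate
    tangents. Its divergence has no x-part since II0 is trace-free, normal part - |II0|^2, and
    tangential part - grad H by Codazzi. Pairing with s, where s.n = H, produces the term - |II0|^2
    H that the Willmore expression cancels; what remains is the derivative of s against Z_j together
    with the time components of the Minkowski product. *)

(** A directional derivative sees only the restriction to a line. This one transfer principle serves
    for restriction to lines, for the chain rule with the square root and for the coordinates on R x
    M. *)
Lemma is_derive_line (R : numFieldType) (U V W : normedModType R)
    (f : V -> W) (g : U -> W) (x v : V) (y w : U) (df : W) :
  (forall h, g (h *: w + y) = f (h *: v + x)) ->
  is_derive x v f df -> is_derive y w g df.
Proof.
move=> gf; have gfx : g y = f x by have := gf 0; rewrite !scale0r !add0r.
have E : (fun h => h^-1 *: ((g \o shift y) (h *: w) - g y)) =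
         (fun h => h^-1 *: ((f \o shift x) (h *: v) - f x)).
  by apply/funext => h /=; rewrite gf gfx.
by case=> fx fd; split; rewrite /derivable /derive E.
Qed.

(** * Symmetry of mixed directional derivatives *)

Section Schwarz.
Context {R : realType} {V : normedModType R}.
Implicit Types (f : V -> R) (a v w : V).

Lemma is_derive_restrict f a v s :
  derivable f (s *: v + a) v ->
  is_derive s 1 (fun s => f (s *: v + a)) ('D_v f (s *: v + a)).
Proof.
move=> /derivableP; apply: is_derive_line => h.
by rewrite scalerDl addrA [h *: (1 : R^o)]mulr1.
Qed.

Lemma MVT_line f a v (h : R) : 0 < h ->
  (forall s : R, 0 <= s <= h -> derivable f (s *: v + a) v) ->
  exists2 c, 0 < c < h & f (h *: v + a) - f a = h * 'D_v f (c *: v + a).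
Proof.
move=> h0 fd.
have [||c ch E] := @MVT R (fun s => f (s *: v + a))
  (fun s => 'D_v f (s *: v + a)) 0 h h0.
- move=> s; rewrite in_itv/= => /andP[s0 sh]; apply: is_derive_restrict.
  by apply: fd; rewrite !ltW.
- apply: derivable_within_continuous => s; rewrite in_itv/= => sh.
  by have [] := is_derive_restrict (fd _ sh).
- exists c; first by move: ch; rewrite in_itv.
  by rewrite /= scale0r add0r subr0 in E; rewrite E mulrC.
Qed.

(* The mean value theorem, applied in the direction v to b |-> f (h w + b) - f b and
   then in the direction w to 'D_v f. *)
Lemma second_difference f a v w (h : R) : 0 < h ->
  (forall s t : R, 0 <= s <= h -> 0 <= t <= h ->
    let b := s *: v + t *: w + a in
    derivable f b v /\ derivable ('D_v f) b w) ->
  exists s t, [/\ 0 < s < h, 0 < t < h &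
    f (h *: v + h *: w + a) - f (h *: v + a) - f (h *: w + a) + f a =
    h ^+ 2 * 'D_w ('D_v f) (s *: v + t *: w + a)].
Proof.
move=> h0 fd; pose g b := f (h *: w + b) - f b.
have hh : 0 <= h <= h by apply/andP; split => //; exact: ltW.
have h00 : 0 <= (0 : R) <= h by apply/andP; split => //; exact: ltW.
have gd s : 0 <= s <= h -> is_derive (s *: v + a) v g
    ('D_v f (h *: w + (s *: v + a)) - 'D_v f (s *: v + a)).
  move=> sh; apply: is_deriveB.
    apply: (@is_derive_line _ _ _ _ f _ (h *: w + (s *: v + a)) v).
      by move=> k; rewrite !addrA (addrC (h *: w)).
    apply: derivableP; rewrite addrCA addrA.
    exact: (fd s h sh hh).1.
  apply: derivableP; have := (fd s 0 sh h00).1.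
  rewrite scale0r addr0; exact.
have [|s sh E1] := @MVT_line g a v h h0.
  by move=> s /gd [].
have sh' : 0 <= s <= h by case/andP: sh => ? ?; rewrite !ltW.
have [|t th E2] := @MVT_line ('D_v f) (s *: v + a) w h h0.
  move=> t th; have [_] := fd s t sh' th.
  by rewrite (addrC (s *: v)) -addrA.
exists s, t; split; [exact: sh|exact: th|].
have -> : f (h *: v + h *: w + a) - f (h *: v + a) - f (h *: w + a) + f a =
    g (h *: v + a) - g a.
  by rewrite /g (addrCA (h *: w)) (addrA (h *: v)) opprB addrA addrAC.
rewrite E1 (derive_val (is_derive := gd _ sh')) E2 expr2 mulrA.
have -> : s *: v + t *: w + a = t *: w + (s *: v + a).
  by rewrite addrA (addrC (t *: w)).
exact: erefl.
Qed.

(** The second difference is symmetric in v and w, so the two mixed derivatives take a common value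
    at two points near a. By continuity each is there within half of the supposed gap of its value
    at a, which contradicts the triangle inequality. *)
Lemma derive_comm f a v w :
  (\forall b \near a, [/\ derivable f b v, derivable f b w,
     derivable ('D_v f) b w & derivable ('D_w f) b v]) ->
  {for a, continuous ('D_w ('D_v f))} -> {for a, continuous ('D_v ('D_w f))} ->
  'D_w ('D_v f) a = 'D_v ('D_w f) a.
Proof.
move=> fd /cvgrPdist_lt cwv /cvgrPdist_lt cvw.
apply/eqP; rewrite -subr_eq0 -normr_eq0; apply/negPn/negP => n0.
have e0 : 0 < `|'D_w ('D_v f) a - 'D_v ('D_w f) a| / 2.
  by rewrite divr_gt0// lt_def n0/=.
have [r /= r0 B] :=
  (nbhs_ballP a _).1 (filterI fd (filterI (cwv _ e0) (cvw _ e0))).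
(* The step h satisfies h K = r / 2, which keeps the whole parallelogram inside the ball; the
   summand 1 keeps K positive when v and w vanish. *)
pose K := `|v| + `|w| + 1; have K0 : 0 < K by rewrite ltr_wpDl.
pose h := r / 2 / K; have h0 : 0 < h by rewrite !divr_gt0.
have near (s t : R) : 0 <= s <= h -> 0 <= t <= h -> ball a r (s *: v + t *: w + a).
  move=> /andP[s0 sh] /andP[t0 th].
  rewrite -ball_normE /ball_/= opprD addrCA subrr addr0 normrN.
  apply: (@le_lt_trans _ _ (h * K)); last first.
    by rewrite /h mulfVK ?gt_eqF// ltr_pdivrMr// ltr_pMr// ltr1n.
  apply: le_trans (ler_normD _ _) _; rewrite !normrZ !ger0_norm//.
  rewrite /K !mulrDr mulr1 -addrA; apply: lerD; first exact: ler_wpM2r.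
  by apply: ler_wpDr; [exact: ltW|exact: ler_wpM2r].
have lt2 (s : R) : 0 < s < h -> 0 <= s <= h by case/andP => ? ?; rewrite !ltW.
have [|s1 [t1 [/lt2 s1h /lt2 t1h E1]]] := @second_difference f a v w h h0.
  by move=> s t sh th; case: (B _ (near s t sh th)) => -[d1 _ d2 _] _;
    split; [exact: d1|exact: d2].
have [|s2 [t2 [/lt2 s2h /lt2 t2h E2]]] := @second_difference f a w v h h0.
  move=> s t sh th; rewrite (addrC (s *: w)).
  by case: (B _ (near t s th sh)) => -[_ d1 _ d2] _; split; [exact: d1|exact: d2].
have [_ [B1 _]] := B _ (near _ _ s1h t1h).
have [_ [_ B2]] := B _ (near _ _ t2h s2h).
rewrite (addrC (t2 *: v)) in B2.
suff E : 'D_w ('D_v f) (s1 *: v + t1 *: w + a) =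
         'D_v ('D_w f) (s2 *: w + t2 *: v + a).
  have split2 (p q z : R) : `|p - z| < `|p - q| / 2 -> `|q - z| < `|p - q| / 2 ->
      False.
    move=> pz qz; have := ler_distD z p q; rewrite (distrC z q).
    by move=> /le_lt_trans/(_ (ltrD pz qz)); rewrite -splitr ltxx.
  rewrite E in B1; exact: split2 B1 B2.
have h2 : h ^+ 2 != 0 by rewrite expf_neq0 ?gt_eqF.
apply: (mulfI h2); apply: etrans (etrans (esym E1) _) E2.
by rewrite (addrC (h *: w) (h *: v)); congr (_ + _); exact: addrAC.
Qed.

End Schwarz.

(** * Two by two matrices: determinant, trace and inverse *)

Section TwoByTwo.
Context {F : fieldType}.
Implicit Types A B : 'M[F]_2.

Lemma sum_ord2 (V : nmodType) (f : 'I_2 -> V) : \sum_i f i = f 0 + f 1.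
Proof. by rewrite big_ord_recl big_ord1; congr (_ + f _); apply: val_inj. Qed.

Lemma ord2_case (i : 'I_2) : i = 0 \/ i = 1.
Proof. by case: i => -[|[|//]] i2; [left|right]; apply: val_inj. Qed.

Lemma eq_mx22 A B :
  A 0 0 = B 0 0 -> A 0 1 = B 0 1 -> A 1 0 = B 1 0 -> A 1 1 = B 1 1 -> A = B.
Proof.
by move=> *; apply/matrixP => i j; case: (ord2_case i) => ->; case: (ord2_case j) => ->.
Qed.

Lemma det_mx22 A : \det A = A 0 0 * A 1 1 - A 0 1 * A 1 0.
Proof.
rewrite (expand_det_row A 0) sum_ord2 /cofactor !det_mx11 !mxE /=.
have -> : lift 0 0 = 1 :> 'I_2 by apply: val_inj.
have -> : lift 1 0 = 0 :> 'I_2 by apply: val_inj.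
by rewrite expr0 expr1 mul1r mulN1r mulrN.
Qed.

Lemma tr_mx22 A : \tr A = A 0 0 + A 1 1.
Proof. by rewrite /mxtrace sum_ord2. Qed.

Lemma mulmx22E A B i j : (A *m B) i j = A i 0 * B 0 j + A i 1 * B 1 j.
Proof. by rewrite mxE sum_ord2. Qed.

(** This is Cayley-Hamilton. Writing the adjugate as trace minus matrix lets trace-freeness act
    directly in [ruled_trace]. *)
Lemma invmx22 A : A \in unitmx ->
  invmx A = (\det A)^-1 *: ((\tr A)%:M - A).
Proof.
move=> Au; have d0 : \det A != 0 by rewrite -unitfE -unitmxE.
apply: (can_inj (mulKmx Au)); rewrite mulmxV// -scalemxAr.
by apply: eq_mx22; rewrite !(mulmx22E, mxE) /= det_mx22 tr_mx22 in d0 *; field.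
Qed.

Lemma invmx22E A : A \in unitmx ->
  [/\ invmx A 0 0 = A 1 1 / \det A, invmx A 0 1 = - A 0 1 / \det A,
      invmx A 1 0 = - A 1 0 / \det A & invmx A 1 1 = A 0 0 / \det A].
Proof. by move=> Au; rewrite invmx22//; split; rewrite !mxE tr_mx22 /=; ring. Qed.

End TwoByTwo.

(** * Inner products and frame expansions in Euclidean space *)

Section DotProduct.
Context {R : realType} {k : nat}.
Implicit Types u v w : 'rV[R]_k.

Lemma dotE u v : dot u v = \sum_i u 0 i * v 0 i.
Proof. by rewrite /dot mxE; apply: eq_bigr => i _; rewrite mxE. Qed.

Lemma dotDr u v w : dot w (u + v) = dot w u + dot w v.
Proof. by rewrite dotC dotDl !(dotC w). Qed.

Lemma dotZr a u w : dot w (a *: u) = a * dot w u.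
Proof. by rewrite dotC dotZl dotC. Qed.

Lemma dotNl u w : dot (- u) w = - dot u w.
Proof. by rewrite -scaleN1r dotZl mulN1r. Qed.

Lemma dotNr u w : dot w (- u) = - dot w u.
Proof. by rewrite dotC dotNl dotC. Qed.

Definition dot_lin := (@dotDl R k, dotDr, @dotZl R k, dotZr, dotNl, dotNr).

Lemma dot_ge0 u : 0 <= dot u u.
Proof. by rewrite dotE sumr_ge0// => i _; rewrite -expr2 sqr_ge0. Qed.

Lemma dot_eq0 u : (dot u u == 0) = (u == 0).
Proof.
apply/eqP/eqP => [|->]; last by rewrite /dot mul0mx mxE.
rewrite dotE => /eqP; rewrite psumr_eq0 => [/allP u0|i _]; last first.
  by rewrite -expr2 sqr_ge0.
apply/rowP => i; rewrite mxE; apply/eqP.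
by have := u0 i (mem_index_enum _); rewrite /= mulf_eq0 orbb.
Qed.

(** Biorthogonality says E F^T = 1; as the matrices are square, F^T E = 1 follows and can be
    inserted between a and b. *)
Lemma dot_dual_basis (e f : 'I_k -> 'rV[R]_k) :
  (forall i j, dot (e i) (f j) = (i == j)%:R) ->
  forall a b, dot a b = \sum_i dot a (f i) * dot (e i) b.
Proof.
move=> ef a b; pose E := \matrix_i e i; pose F := \matrix_i f i.
have EF : E *m F^T = 1%:M.
  by apply/matrixP => i j; rewrite !mxE -ef dotE; apply: eq_bigr => l _; rewrite !mxE.
have -> : dot a b = ((a *m F^T) *m (E *m b^T)) 0 0.
  by rewrite mulmxA -(mulmxA a) (mulmx1C EF) mulmx1.
rewrite mxE; apply: eq_bigr => i _; rewrite !dotE !mxE; congr (_ * _).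
  by apply: eq_bigr => l _; rewrite !mxE.
by apply: eq_bigr => l _; rewrite !mxE.
Qed.

End DotProduct.

Section Frame.
Context {R : realType}.

(** The tangent vectors are constrained only by a nonzero Gram determinant, so coordinate vectors of
    any chart qualify. *)
Definition is_frame (x n X1 X2 : 'rV[R]_4) :=
  [/\ dot x x = 1, dot n n = 1, dot n x = 0 &
   [/\ dot X1 x = 0, dot X2 x = 0, dot n X1 = 0, dot n X2 = 0 &
       dot X1 X1 * dot X2 X2 - dot X1 X2 ^+ 2 != 0]].

(** The dual basis of the tangent part comes from inverting the Gram matrix of X1, X2. This
    expansion reduces vector identities to goals for [field]. *)
Lemma dot_frame (x n X1 X2 a b : 'rV[R]_4) : is_frame x n X1 X2 ->
  dot a b = dot a x * dot b x + dot a n * dot b n +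
    (dot X2 X2 * (dot a X1 * dot b X1)
     - dot X1 X2 * (dot a X1 * dot b X2 + dot a X2 * dot b X1)
     + dot X1 X1 * (dot a X2 * dot b X2)) /
    (dot X1 X1 * dot X2 X2 - dot X1 X2 ^+ 2).
Proof.
case=> xx nn nx [x1 x2 n1 n2]; set d := _ - _ => d0.
pose e := tnth [tuple x; n; X1; X2].
pose f := tnth [tuple x; n; d^-1 *: (dot X2 X2 *: X1 + - (dot X1 X2 *: X2));
                d^-1 *: (dot X1 X1 *: X2 + - (dot X1 X2 *: X1))].
rewrite (@dot_dual_basis _ _ e f).
  rewrite !big_ord_recl big_ord0 /e /f !(tnth_nth 0) /= !dot_lin.
  by rewrite !(dotC _ b); field.
have rels := (xx, nn, nx, x1, x2, n1, n2, dotC x X1, dotC x X2, dotC X1 n,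
  dotC X2 n, dotC x n, dotC X2 X1).
move=> [[|[|[|[|//]]]] i4] [[|[|[|[|//]]]] j4].
all: rewrite /e /f !(tnth_nth 0) /= ?dot_lin ?rels /= ?mulr0 ?oppr0 ?addr0 ?mulr0 //.
all: by rewrite /d in d0 *; field.
Qed.

End Frame.

(* The tangential component of the identity of [dot_grad_divergence] below, with the
   inner products as unknowns: a_ijk = x_ij.x_k, b_ijk = n_ij.x_k, xn_ijk = x_ij.n_k
   and p, q, r = x_1.n_1, x_1.n_2, x_2.n_2. *)
Section CodazziScalars.
Context {R : realType}.

Lemma codazzi_tangential (g11 g12 g22 p q r H H1 H2
    a111 a112 a121 a122 a221 a222 b111 b112 b121 b122 b221 b222
    xn111 xn112 xn121 xn122 xn221 xn222 : R) :
  let d := g11 * g22 - g12 ^+ 2 in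
  let d1 := 2 * a111 * g22 + g11 * (2 * a122) - 2 * g12 * (a112 + a121) in
  let d2 := 2 * a121 * g22 + g11 * (2 * a222) - 2 * g12 * (a122 + a221) in
  let xn a b m m' := (g22 * (a * m) - g12 * (a * m' + b * m) + g11 * (b * m')) / d in
  d != 0 ->
  xn111 = xn a111 a112 p q -> xn112 = xn a111 a112 q r ->
  xn121 = xn a121 a122 p q -> xn122 = xn a121 a122 q r ->
  xn221 = xn a221 a222 p q -> xn222 = xn a221 a222 q r ->
  xn112 + b121 = xn121 + b112 -> xn122 + b221 = xn221 + b122 ->
  2 * H * d = - (g22 * p - 2 * g12 * q + g11 * r) ->
  2 * (H1 * d + H * d1) =
    - (2 * a122 * p + g22 * (xn111 + b111)
       - 2 * ((a112 + a121) * q + g12 * (xn112 + b121))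
       + (2 * a111 * r + g11 * (xn122 + b122))) ->
  2 * a122 * (H * g11 + p) - (a112 + a121) * (H * g12 + q)
    + g22 * (H1 * g11 + H * a111 + b111) - g12 * (H1 * g12 + H * a121 + b121)
    - d1 / (2 * d) * (g22 * (H * g11 + p) - g12 * (H * g12 + q))
  + (- ((a122 + a221) * (H * g11 + p)) + 2 * a121 * (H * g12 + q)
    - g12 * (H2 * g11 + H * a121 + b121) + g11 * (H2 * g12 + H * a221 + b221)
    - d2 / (2 * d) * (- (g12 * (H * g11 + p)) + g11 * (H * g12 + q)))
  = - d * H1.
Proof.
move=> d d1 d2 xn d0 E1 E2 E3 E4 E5 E6 c1 c2 EH EH1.
have {EH} EH : H = - (g22 * p - 2 * g12 * q + g11 * r) / (2 * d).
  by rewrite -EH; field.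
have {EH1} EH1 : H1 = - (2 * a122 * p + g22 * (xn111 + b111)
       - 2 * ((a112 + a121) * q + g12 * (xn112 + b121))
       + (2 * a111 * r + g11 * (xn122 + b122))) / (2 * d) - H * d1 / d.
  by rewrite -EH1; field.
have {c1} c1 : b112 = xn112 + b121 - xn121 by rewrite c1; ring.
(* The left side of the goal contains [b221] where H_1 contains [b122]; this Codazzi equation
   exchanges them. *)
have {c2} c2 : b221 = xn221 + b122 - xn122 by rewrite -c2; ring.
rewrite EH1 EH c2 E1 E2 E4 E5 /xn /d1 /d2 /d in d0 *.
by field.
Qed.

End CodazziScalars.

(** * Codazzi equations and the divergence of the trace-free second form *)

Section Codazzi.
Context {R : realType}.
Variables (x n X1 X2 N1 N2 X11 X12 X22 N11 N12 N22 : 'rV[R]_4) (H H1 H2 : R).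

Let g11 := dot X1 X1.
Let g12 := dot X1 X2.
Let g22 := dot X2 X2.
Let d := g11 * g22 - g12 ^+ 2.
Let d1g11 := 2 * dot X11 X1.
Let d1g12 := dot X11 X2 + dot X12 X1.
Let d1g22 := 2 * dot X12 X2.
Let d2g11 := 2 * dot X12 X1.
Let d2g12 := dot X12 X2 + dot X22 X1.
Let d2g22 := 2 * dot X22 X2.
Let d1 := d1g11 * g22 + g11 * d1g22 - 2 * g12 * d1g12.
Let d2 := d2g11 * g22 + g11 * d2g22 - 2 * g12 * d2g12.
Let Z1 := H *: X1 + N1.
Let Z2 := H *: X2 + N2.
Let Z11 := H1 *: X1 + H *: X11 + N11.
(** [Z12] is d_1 Z_2 and [Z21] is d_2 Z_1; they differ by H_1 x_2 - H_2 x_1. *)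
Let Z12 := H1 *: X2 + H *: X12 + N12.
Let Z21 := H2 *: X1 + H *: X12 + N12.
Let Z22 := H2 *: X2 + H *: X22 + N22.

Hypothesis frame : is_frame x n X1 X2.
Hypotheses (N1x : dot N1 x = 0) (N2x : dot N2 x = 0).
Hypotheses (N1n : dot N1 n = 0) (N2n : dot N2 n = 0).
Hypothesis h_sym : dot X2 N1 = dot X1 N2.
Hypotheses (X11x : dot X11 x = - g11) (X12x : dot X12 x = - g12)
  (X22x : dot X22 x = - g22).
Hypotheses (X11n : dot X11 n = - dot X1 N1) (X12n : dot X12 n = - dot X1 N2)
  (X22n : dot X22 n = - dot X2 N2).
Hypotheses (N11x : dot N11 x = - dot X1 N1) (N12x : dot N12 x = - dot X1 N2)
  (N22x : dot N22 x = - dot X2 N2).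
Hypotheses (N11n : dot N11 n = - dot N1 N1) (N12n : dot N12 n = - dot N1 N2)
  (N22n : dot N22 n = - dot N2 N2).
Hypothesis codazzi1 : dot X11 N2 + dot X1 N12 = dot X12 N1 + dot X2 N11.
Hypothesis codazzi2 : dot X12 N2 + dot X1 N22 = dot X22 N1 + dot X2 N12.
Hypothesis H_def :
  2 * H * d = - (g22 * dot X1 N1 - 2 * g12 * dot X1 N2 + g11 * dot X2 N2).
Hypothesis H1_def : 2 * (H1 * d + H * d1) =
  - (d1g22 * dot X1 N1 + g22 * (dot X11 N1 + dot X1 N11)
     - 2 * (d1g12 * dot X1 N2 + g12 * (dot X11 N2 + dot X1 N12))
     + (d1g11 * dot X2 N2 + g11 * (dot X12 N2 + dot X2 N12))).
Hypothesis H2_def : 2 * (H2 * d + H * d2) =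
  - (d2g22 * dot X1 N1 + g22 * (dot X12 N1 + dot X1 N12)
     - 2 * (d2g12 * dot X1 N2 + g12 * (dot X12 N2 + dot X1 N22))
     + (d2g11 * dot X2 N2 + g11 * (dot X22 N2 + dot X2 N22))).

(* With Z_j = H x_j + n_j, this is sqrt d times the sum of the
   d_i (adj(g)^{ij} Z_j / sqrt d), all derivatives being expanded. *)
Definition grad_divergence :=
  (d1g22 *: Z1 + - (d1g12 *: Z2) + g22 *: Z11 + - (g12 *: Z12)
    + - ((d1 / (2 * d)) *: (g22 *: Z1 + - (g12 *: Z2))))
  + (- (d2g12 *: Z1) + d2g11 *: Z2 + - (g12 *: Z21) + g11 *: Z22
    + - ((d2 / (2 * d)) *: (- (g12 *: Z1) + g11 *: Z2))).

(** The vector is determined by its products with the frame. Along x it gives the trace of II0,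
    hence 0; along n it gives - d |II0|^2, with |II0|^2 = 2 (H^2 - det II / d); along x_k it gives -
    d H_k, because the divergence of II0 is dH by Codazzi. *)
Lemma dot_grad_divergence s : dot s grad_divergence =
  - (2 * (H ^+ 2 * d - (dot X1 N1 * dot X2 N2 - dot X1 N2 ^+ 2)) * dot s n
     + (g22 * H1 * dot s X1 - g12 * (H1 * dot s X2 + H2 * dot s X1)
        + g11 * H2 * dot s X2)).
Proof.
case: (frame) => xx nn nx [x1 x2 n1 n2 d0].
have VN V N : dot N x = 0 -> dot N n = 0 -> dot V N =
    (g22 * (dot V X1 * dot X1 N) -
     g12 * (dot V X1 * dot X2 N + dot V X2 * dot X1 N)
     + g11 * (dot V X2 * dot X2 N)) / d.
  move=> Nx Nn; rewrite (dot_frame V N frame) Nx Nn !mulr0 !add0r.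
  by rewrite !(dotC _ N).
have E1 := VN _ _ N1x N1n; have E2 := VN _ _ N2x N2n.
have n1' : dot X1 n = 0 by rewrite dotC.
have n2' : dot X2 n = 0 by rewrite dotC.
have d0' : g11 * g22 - g12 ^+ 2 != 0 by [].
have EH : H = - (g22 * dot X1 N1 - 2 * g12 * dot X1 N2 + g11 * dot X2 N2) / (2 * d).
  by rewrite -H_def; field.
pose rels := (h_sym, n1', n2', x1, x2, N1x, N2x, N1n, N2n, X11x, X12x, X22x,
  X11n, X12n, X22n, N11x, N12x, N22x, N11n, N12n, N22n).
have Ux : dot grad_divergence x = 0.
  rewrite /grad_divergence !dot_lin !rels EH /d in d0 *.
  by field.
have Un : dot grad_divergence n =
    - 2 * (H ^+ 2 * d - (dot X1 N1 * dot X2 N2 - dot X1 N2 ^+ 2)).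
  rewrite /grad_divergence !dot_lin !rels (E1 N1) (E2 N1) (E2 N2).
  rewrite !(dotC N1) !(dotC N2) h_sym EH.
  by rewrite /d in d0 *; field.
(* Inside the expansion of V.N1, the product X2.N1 is replaced by X1.N2, so that only three entries
   of the second form remain. *)
have {}E1 := fun V => etrans (E1 V) (congr1
  (fun q => (g22 * (dot V X1 * _) - g12 * (dot V X1 * q + _) + g11 * (_ * q)) / d)
  h_sym).
have U1 : dot grad_divergence X1 = - d * H1.
  rewrite -(@codazzi_tangential R g11 g12 g22 (dot X1 N1) (dot X1 N2) (dot X2 N2)
    H H1 H2 (dot X11 X1) (dot X11 X2) (dot X12 X1) (dot X12 X2) (dot X22 X1)
    (dot X22 X2) (dot X1 N11) (dot X2 N11) (dot X1 N12) (dot X2 N12) (dot X1 N22)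
    (dot X2 N22) _ _ _ _ _ _ d0' (E1 X11) (E2 X11) (E1 X12) (E2 X12) (E1 X22)
    (E2 X22) codazzi1 codazzi2 H_def H1_def).
  rewrite /grad_divergence !dot_lin.
  rewrite /d2 /d1 /d2g22 /d2g12 /d2g11 /d1g22 /d1g12 /d1g11 /d /g22 /g12 /g11.
  by rewrite !(dotC _ X1).
(* The scalar identity is reused with the two coordinates exchanged; only the naming of symmetric
   products has to be adjusted. *)
have U2 : dot grad_divergence X2 = - d * H2.
  have dE : g22 * g11 - g12 ^+ 2 = d by rewrite mulrC.
  rewrite -dE -(@codazzi_tangential R g22 g12 g11 (dot X2 N2) (dot X1 N2) (dot X1 N1)
    H H2 H1 (dot X22 X2) (dot X22 X1) (dot X12 X2) (dot X12 X1) (dot X11 X2)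
    (dot X11 X1) (dot X2 N22) (dot X1 N22) (dot X2 N12) (dot X1 N12) (dot X2 N11)
    (dot X1 N11) (dot X22 N2) (dot X22 N1) (dot X12 N2) (dot X12 N1)
    (dot X11 N2) (dot X11 N1)).
  - rewrite /grad_divergence !dot_lin.
    rewrite /d2 /d1 /d2g22 /d2g12 /d2g11 /d1g22 /d1g12 /d1g11 /d /g22 /g12 /g11 in d0 *.
    rewrite !(dotC _ X2) in d0 *; rewrite h_sym; field.
    rewrite mulrC (dotC X2 X1); exact: d0'.
  - by rewrite (mulrC g22).
  - by rewrite E2 (mulrC g22 g11); ring.
  - by rewrite E1 (mulrC g22 g11); ring.
  - by rewrite E2 (mulrC g22 g11); ring.
  - by rewrite E1 (mulrC g22 g11); ring.
  - by rewrite E2 (mulrC g22 g11); ring.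
  - by rewrite E1 (mulrC g22 g11); ring.
  - by rewrite -codazzi2.
  - by rewrite codazzi1.
  - by rewrite (mulrC g22 g11) H_def; ring.
  - by rewrite -codazzi2; apply: etrans (etrans _ H2_def) _;
    rewrite /d2 /d1 /d2g22 /d2g12 /d2g11 /d1g22 /d1g12 /d1g11 /d /g22 /g12 /g11; ring.
rewrite (dot_frame s _ frame) Ux Un U1 U2 -/d.
move: d0; rewrite -/g11 -/g12 -/g22 -/d => d0.
by field.
Qed.

End Codazzi.

(** * Traces of the block forms of the ruled surface *)

Section SchurComplement.
Context {F : fieldType} {n : nat}.
Implicit Types (b : 'rV[F]_n) (D E : 'M[F]_n).

Lemma block_schur_factor b D :
  block_mx 1%:M b b^T D =
  block_mx 1%:M 0 b^T 1%:M *m block_mx 1%:M b 0 (D - b^T *m b).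
Proof.
rewrite mulmx_block !mul1mx !mulmx1 !mul0mx ?mulmx0 !addr0.
by rewrite addrC subrK.
Qed.

Lemma unitmx_block_schur b D :
  (block_mx 1%:M b b^T D \in unitmx) = (D - b^T *m b \in unitmx).
Proof.
by rewrite block_schur_factor !unitmxE det_mulmx det_lblock det_ublock !det1 !mul1r.
Qed.

(** The second form lives in the lower right block, where the inverse of the first form is the
    inverse of the Schur complement. Hence the ruling direction drops out of the trace. *)
Lemma tr_block_schur b D E : D - b^T *m b \in unitmx ->
  \tr (invmx (block_mx 1%:M b b^T D) *m block_mx 0 0 0 E) =
  \tr (invmx (D - b^T *m b) *m E).
Proof.
move=> Su; set S := _ - _ in Su *; set Y := _ *m E.
have Iu : block_mx 1%:M b b^T D \in unitmx by rewrite unitmx_block_schur.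
(* Instead of computing the inverse, the second form is exhibited as the first form times an upper
   triangular block matrix whose trace is visible. *)
have <- : block_mx 1%:M b b^T D *m block_mx 0 (- (b *m Y)) 0 Y =
    block_mx (0 : 'M[F]_(1, 1)) 0 0 E.
  rewrite mulmx_block !mul1mx !mulmx0 !addr0 addNr; congr (block_mx _ _ _ _).
  have -> : D = b^T *m b + S by rewrite addrC subrK.
  by rewrite mulmxDl mulmxN mulmxA addKr /Y mulKVmx.
by rewrite mulKmx// mxtrace_block mxtrace0 add0r.
Qed.

End SchurComplement.

Section RuledTrace.
Context {R : realType}.
Variables (g A P : 'M[R]_2) (c : R).
Hypotheses (c0 : 0 < c) (g_unit : g \in unitmx) (g_sym : g^T = g) (A_sym : A^T = A).
Hypothesis A_tracefree : \tr (invmx g *m A) = 0.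

(** With c = e^t and A = II0, [S] is the Schur complement of the ruling direction in the first form
    of x^+, [E] is the nonzero block of its second form, and [D] is the matrix C of the overview. *)
Let S := 2^-1 *: (c ^+ 2 *: g + (P + P^T) + c ^- 2 *: (P *m invmx g *m P^T)).
Let E := (Num.sqrt 2)^-1 *: (c *: A + c^-1 *: (P *m invmx g *m A)).
Let D := c%:M + c^-1 *: (P *m invmx g).

Let c_neq0 : c != 0. Proof. exact: lt0r_neq0. Qed.

Let trD : D^T = c%:M + c^-1 *: (invmx g *m P^T).
Proof.
by rewrite /D linearD linearZ /= tr_scalar_mx trmx_mul trmx_inv g_sym.
Qed.

Lemma ruled_metric_factor : S = 2^-1 *: (D *m g *m D^T).
Proof.
have -> : D *m g = c *: g + c^-1 *: P.
  by rewrite /D mulmxDl mul_scalar_mx -scalemxAl mulmxKV.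
rewrite trD /S mulmxDr !mul_mx_scalar -scalemxAr !mulmxDl -!scalemxAl !mulmxA.
congr (_ *: _); rewrite mulmxV// mul1mx !scalerDr !scalerA mulfV// mulVf// !scale1r.
by rewrite -exprVn !expr2 !addrA.
Qed.

Lemma ruled_second_factor : E = (Num.sqrt 2)^-1 *: (D *m A).
Proof. by rewrite /E /D mulmxDl mul_scalar_mx -scalemxAl. Qed.

Lemma ruled_metric_unit : (S \in unitmx) = (\det D != 0).
Proof.
rewrite ruled_metric_factor unitmxZ ?unitfE ?invr_eq0 ?pnatr_eq0//.
by rewrite !unitmx_mul unitmx_tr g_unit andbT andbb unitmxE unitfE.
Qed.

(** The factor D cancels on the left and leaves the inverse of D^T against g^{-1} A. By
    Cayley-Hamilton this inverse is (tr D - D^T) / det D. Scalar matrices contribute nothing because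
    g^{-1} A is trace-free, so only the term c^{-1} g^{-1} P^T of D^T survives. Symmetry of g and A
    then lets P replace its transpose under the trace. *)
Lemma ruled_trace : S \in unitmx ->
  \tr (invmx S *m E) =
  - (Num.sqrt 2 / (c * \det D) * \tr (invmx g *m P *m invmx g *m A)).
Proof.
move=> Su; have d0 : \det D != 0 by rewrite -ruled_metric_unit.
have Du : D \in unitmx by rewrite unitmxE unitfE.
have DTu : D^T \in unitmx by rewrite unitmx_tr.
have s0 : Num.sqrt 2 != 0 :> R by rewrite gt_eqF// sqrtr_gt0.
have SE : invmx S *m E = Num.sqrt 2 *: (invmx D^T *m (invmx g *m A)).
  apply: (can_inj (mulKmx Su)); rewrite mulKVmx//.
  rewrite ruled_metric_factor ruled_second_factor -!scalemxAl -!scalemxAr scalerA.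
  rewrite !mulmxA !mulmxK//; congr (_ *: _).
  by apply: (mulIf s0); rewrite mulVf// -mulrA -expr2 sqr_sqrtr// mulVf ?pnatr_eq0.
rewrite SE mxtraceZ invmx22// det_tr mxtrace_tr -scalemxAl mxtraceZ mulmxBl.
rewrite linearB /= mul_scalar_mx mxtraceZ A_tracefree mulr0 sub0r trD mulmxDl.
rewrite linearD /= mul_scalar_mx mxtraceZ A_tracefree mulr0 add0r.
rewrite -scalemxAl mxtraceZ.
have -> : \tr (invmx g *m P^T *m (invmx g *m A)) =
    \tr (invmx g *m P *m invmx g *m A).
  rewrite -mxtrace_tr !trmx_mul trmxK trmx_inv g_sym A_sym.
  by rewrite [LHS]mxtrace_mulC !mulmxA mxtrace_mulC !mulmxA.
by field; rewrite d0 c_neq0.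
Qed.

End RuledTrace.

(** With s = c^2, the determinant times c^2 is the quadratic s^2 + s tr N + det N. The choice s = 1
    + |tr N| + |det N| bounds it below by s (1 + |det N|) - |det N|, which is positive since s >=
    1. *)
Lemma exists_det_neq0 (R : realType) (N : 'M[R]_2) :
  exists t : R, \det ((expR t)%:M + (expR t)^-1 *: N) != 0.
Proof.
pose s := 1 + `|\tr N| + `|\det N|.
have s0 : 0 < s by rewrite /s -addrA ltr_pwDl// addr_ge0.
exists (ln s / 2); set c := expR _.
have c0 : 0 < c by exact: expR_gt0.
have cc : c ^+ 2 = s by rewrite -expRM_natl mulrC divfK ?pnatr_eq0// lnK.
suff : 0 < c ^+ 2 * \det (c%:M + c^-1 *: N).
  by rewrite pmulr_rgt0 ?exprn_gt0// => /lt0r_neq0.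
have -> : c ^+ 2 * \det (c%:M + c^-1 *: N) = s * s + s * \tr N + \det N.
  rewrite -cc !det_mx22 tr_mx22 !mxE /= ?mulr1n ?mulr0n.
  by field; rewrite gt_eqF.
have trN : - `|\tr N| <= \tr N by rewrite lerNl -normrN ler_norm.
have detN : - `|\det N| <= \det N by rewrite lerNl -normrN ler_norm.
have := normr_ge0 (\tr N); have := normr_ge0 (\det N).
have sE : s = 1 + `|\tr N| + `|\det N| by [].
clearbody s; nra.
Qed.

(** * Rules for directional derivatives of scalar and matrix-valued maps *)

Section EntrywiseDerivative.
Context {R : realType} {V : normedModType R}.
Implicit Types (x v : V).

Lemma is_derive_mxP m n (F : V -> 'M[R]_(m, n)) x v dF :
  is_derive x v F dF <-> forall i j, is_derive x v (fun w => F w i j) (dF i j).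
Proof.
split=> [[Fx dFx] i j|Fx].
  split; first exact: (derivable_mxP F x v).1 Fx i j.
  by rewrite -dFx derive_mx// mxE.
have Fd : derivable F x v by apply/derivable_mxP => i j; case: (Fx i j).
split=> //; rewrite derive_mx//; apply/matrixP => i j; rewrite mxE.
by case: (Fx i j).
Qed.

Lemma is_derive_rsubmx m n p (F : V -> 'M[R]_(m, n + p)) x v dF :
  is_derive x v F dF -> is_derive x v (fun w => rsubmx (F w)) (rsubmx dF).
Proof.
move=> /is_derive_mxP Fx; apply/is_derive_mxP => i j; rewrite mxE.
by have := Fx i (rshift n j); congr (is_derive _ _ _ _); apply/funext => w; rewrite mxE.
Qed.

Lemma is_derive_lsubmx m n p (F : V -> 'M[R]_(m, n + p)) x v dF :
  is_derive x v F dF -> is_derive x v (fun w => lsubmx (F w)) (lsubmx dF).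
Proof.
move=> /is_derive_mxP Fx; apply/is_derive_mxP => i j; rewrite mxE.
by have := Fx i (lshift p j); congr (is_derive _ _ _ _); apply/funext => w; rewrite mxE.
Qed.

Lemma is_derive_row_mx m n p (F : V -> 'M[R]_(m, n)) (G : V -> 'M[R]_(m, p))
    x v dF dG : is_derive x v F dF -> is_derive x v G dG ->
  is_derive x v (fun w => row_mx (F w) (G w)) (row_mx dF dG).
Proof.
move=> /is_derive_mxP Fx /is_derive_mxP Gx; apply/is_derive_mxP => i j.
rewrite mxE; case: splitP => k jk; [have := Fx i k|have := Gx i k];
  congr (is_derive _ _ _ _); apply/funext => w.
  by rewrite (_ : j = lshift p k) ?row_mxEl//; apply: val_inj.
by rewrite (_ : j = rshift n k) ?row_mxEr//; apply: val_inj.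
Qed.

Lemma is_derive_scale m n (f : V -> R) (F : V -> 'M[R]_(m, n)) x v df dF :
  is_derive x v f df -> is_derive x v F dF ->
  is_derive x v (fun w => f w *: F w) (df *: F x + f x *: dF).
Proof.
move=> fx /is_derive_mxP Fx; apply/is_derive_mxP => i j.
have -> : (fun w => (f w *: F w) i j) = f * (fun w => F w i j).
  by apply/funext => w; rewrite mxE.
by apply: is_derive_eq (is_deriveM fx (Fx i j)) _; rewrite !mxE addrC (mulrC df).
Qed.

Lemma is_derive_dot k (f g : V -> 'rV[R]_k) x v df dg :
  is_derive x v f df -> is_derive x v g dg ->
  is_derive x v (fun w => dot (f w) (g w)) (dot df (g x) + dot (f x) dg).
Proof.
move=> /is_derive_mxP fx /is_derive_mxP gx.
have -> : (fun w => dot (f w) (g w)) =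
    \sum_i ((fun w => f w 0 i) * (fun w => g w 0 i)).
  by apply/funext => w; rewrite fct_sumE dotE.
apply: is_derive_eq (is_derive_sum (fun i => is_deriveM (fx 0 i) (gx 0 i))) _.
rewrite !dotE -big_split/=; apply: eq_bigr => i _.
by rewrite [LHS]addrC; congr (_ + _); exact: mulrC.
Qed.

Lemma is_derive_sqrt (f : V -> R) x v df : 0 < f x -> is_derive x v f df ->
  is_derive x v (fun w => Num.sqrt (f w)) (df / (2 * Num.sqrt (f x))).
Proof.
(* The one-variable chain rule is applied to the restriction of [f] to the line through x along
   v. *)
move=> f0 fx; pose phi h := f (h *: v + x).
have phi0 : phi 0 = f x by rewrite /phi scale0r add0r.
have phid : is_derive (0 : R) 1 phi df.
  apply: is_derive_line fx => h.
  by rewrite /phi addr0 [h *: (1 : R^o)]mulr1.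
have sd : is_derive (phi 0) 1 Num.sqrt (2 * Num.sqrt (f x))^-1.
  by rewrite phi0; exact: is_derive1_sqrt.
have -> : df / (2 * Num.sqrt (f x)) = (2 * Num.sqrt (f x))^-1 *: df by rewrite mulrC.
apply: is_derive_line (is_derive1_comp sd phid) => h.
by rewrite /phi/= addr0 [h *: (1 : R^o)]mulr1.
Qed.

Lemma is_derive_unique_on (W : normedModType R) (D : set V) (f g : V -> W) x v df dg :
  open D -> D x -> (forall w, D w -> f w = g w) ->
  is_derive x v f df -> is_derive x v g dg -> df = dg.
Proof.
move=> oD Dx fg [_ <-] [_ <-]; apply: near_eq_derive.
by apply: filterS (open_nbhs_nbhs (conj oD Dx)) => w; exact: fg.
Qed.

Lemma is_derive_on (W : normedModType R) (D : set V) (f g : V -> W) x v df :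
  open D -> D x -> (forall w, D w -> f w = g w) ->
  is_derive x v f df -> is_derive x v g df.
Proof.
move=> oD Dx fg; apply: near_eq_is_derive.
by apply: filterS (open_nbhs_nbhs (conj oD Dx)) => w; exact: fg.
Qed.

End EntrywiseDerivative.

Section ScalarRules.
Context {R : realType} {V : normedModType R}.
Implicit Types (f g : V -> R) (x v : V).

Lemma is_derive_mul_fun f g x v df dg : is_derive x v f df -> is_derive x v g dg ->
  is_derive x v (fun w => f w * g w) (df * g x + f x * dg).
Proof.
move=> fx gx; apply: is_derive_eq (is_deriveM fx gx) _.
by rewrite [LHS]addrC; congr (_ + _); exact: mulrC.
Qed.

Lemma is_derive_sub_fun f g x v df dg : is_derive x v f df -> is_derive x v g dg ->
  is_derive x v (fun w => f w - g w) (df - dg).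
Proof. exact: is_deriveB. Qed.

Lemma is_derive_sqr_fun f x v df : is_derive x v f df ->
  is_derive x v (fun w => f w ^+ 2) (2 * f x * df).
Proof.
move=> fx; apply: is_derive_eq (is_derive_mul_fun fx fx) _; ring.
Qed.

(** The factor 1 / sqrt g is kept outside, so that the rest is rational; this is the origin of the
    terms d_i / (2 d) in [grad_divergence]. *)
Lemma is_derive_div_sqrt f g x v df dg : 0 < g x ->
  is_derive x v f df -> is_derive x v g dg ->
  is_derive x v (fun w => f w / Num.sqrt (g w))
    ((df - f x * dg / (2 * g x)) / Num.sqrt (g x)).
Proof.
move=> g0 fx gx; have sg := is_derive_sqrt g0 gx.
have s0 : Num.sqrt (g x) != 0 by rewrite gt_eqF// sqrtr_gt0.
have [sd sE] := sg.
have ig : is_derive x v (fun w => (Num.sqrt (g w))^-1)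
    (- Num.sqrt (g x) ^- 2 *: (dg / (2 * Num.sqrt (g x)))).
  by split; [exact: derivableV|rewrite deriveV// sE].
apply: is_derive_eq (is_derive_mul_fun fx ig) _.
rewrite [_ *: _]mulrA; have := sqr_sqrtr (ltW g0); move: s0.
by move: (Num.sqrt (g x)) => r r0 <-; field.
Qed.

End ScalarRules.

(** * Partial derivatives of smooth maps *)

Section SmoothOn.
Context {R : realType} {m : nat}.
Implicit Types (D : set 'rV[R]_m) (u v : 'rV[R]_m) (i j : 'I_m).

Lemma smooth_on_pderiv (W : normedModType R) D (F : 'rV[R]_m -> W) i :
  smooth_on D F -> smooth_on D (pderiv i F).
Proof. by move=> Fs k; exact: (Fs k.+1).2 i. Qed.

Lemma smooth_on_differentiable (W : normedModType R) D (F : 'rV[R]_m -> W) u :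
  smooth_on D F -> D u -> differentiable F u.
Proof. by move=> Fs Du; exact: (Fs 1%N).1 u Du. Qed.

Lemma smooth_on_is_derive (W : normedModType R) D (F : 'rV[R]_m -> W) u i :
  smooth_on D F -> D u -> is_derive u (delta_mx 0 i) F (pderiv i F u).
Proof.
by move=> Fs Du; split=> //; exact: diff_derivable (smooth_on_differentiable Fs Du).
Qed.

Lemma pderiv_comm k D (F : 'rV[R]_m -> 'rV[R]_k) u i j :
  open D -> smooth_on D F -> D u ->
  pderiv i (pderiv j F) u = pderiv j (pderiv i F) u.
Proof.
move=> oD Fs Du; apply/rowP => l; pose f w := F w 0 l.
have D1 i' w : D w -> is_derive w (delta_mx 0 i') f (pderiv i' F w 0 l).
  by move=> Dw; apply: ((is_derive_mxP _ _ _ _).1 (smooth_on_is_derive _ Fs Dw)).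
have D2 i' j' w : D w ->
    is_derive w (delta_mx 0 j') (pderiv i' f) (pderiv j' (pderiv i' F) w 0 l).
  move=> Dw; apply: (is_derive_on (f := fun w => pderiv i' F w 0 l) oD Dw).
    by move=> v /(D1 i') [_ <-].
  exact: ((is_derive_mxP _ _ _ _).1
    (smooth_on_is_derive _ (smooth_on_pderiv i' Fs) Dw)).
(* The iterated derivatives of the entry [f] are known to be entries of those of F only on D, so
   continuity passes through equality near u. *)
have C2 i' j' : {for u, continuous (pderiv j' (pderiv i' f))}.
  have E : \near u, pderiv j' (pderiv i' F) u 0 l = pderiv j' (pderiv i' f) u.
    by apply: filterS (open_nbhs_nbhs (conj oD Du)) => w /(D2 i' j') [_ <-].
  rewrite /prop_for /continuous_at -(nbhs_singleton E : _ = _).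
  apply: cvg_trans (near_eq_cvg E) _.
  have := smooth_on_pderiv j' (smooth_on_pderiv i' Fs) => /(_ 0%N u Du) Fc.
  exact: continuous_comp Fc (@coord_continuous _ _ _ _ _ _).
case: (D2 j i u Du) => _ Eij; case: (D2 i j u Du) => _ Eji.
apply: etrans (esym Eij) (etrans _ Eji); apply: derive_comm; [|exact: C2|exact: C2].
apply: filterS (open_nbhs_nbhs (conj oD Du)) => w Dw.
by split; [exact: (@ex_derive _ _ _ _ _ _ _ (D1 j w Dw))|
  exact: (@ex_derive _ _ _ _ _ _ _ (D1 i w Dw))|
  exact: (@ex_derive _ _ _ _ _ _ _ (D2 j i w Dw))|
  exact: (@ex_derive _ _ _ _ _ _ _ (D2 i j w Dw))].
Qed.

Lemma pderiv_comp k (W : normedModType R) (phi : 'rV[R]_m -> 'rV[R]_k)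
    (f : 'rV[R]_k -> W) u i :
  differentiable phi u -> differentiable f (phi u) ->
  pderiv i (f \o phi) u = \sum_l pderiv i phi u 0 l *: pderiv l f (phi u).
Proof.
move=> dphi df; rewrite /pderiv deriveE; last exact: differentiable_comp.
rewrite diff_comp//= deriveE// [X in 'd f _ X]row_sum_delta linear_sum/=.
by apply: eq_bigr => l _; rewrite linearZ/= deriveE.
Qed.

End SmoothOn.

(** * Behaviour of the fundamental forms under a change of chart *)

(** Here J is the Jacobian of a transition map; its invertibility is read off from that of the
    transformed metric. *)
Lemma tr_invmx_congruence (F : fieldType) m (J g h : 'M[F]_m) :
  J *m g *m J^T \in unitmx ->
  \tr (invmx (J *m g *m J^T) *m (J *m h *m J^T)) = \tr (invmx g *m h).
Proof.
move=> Ju; have := Ju; rewrite !unitmx_mul => /andP[/andP[J0 g0] JT0].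
have -> : invmx (J *m g *m J^T) *m (J *m h *m J^T) =
    invmx J^T *m (invmx g *m h) *m J^T.
  apply: (can_inj (mulKmx Ju)); rewrite mulKVmx// !mulmxA.
  by rewrite (mulmxK JT0) (mulmxK g0).
by rewrite mxtrace_mulC mulKVmx.
Qed.

Section ChartInvariance.
Context {R : realType} {M : topologicalType} (A : smooth_atlas R M).
Context (x n : M -> 'rV[R]_4).
Hypotheses (x_immersed : immersed_in_S3 A x) (n_normal : unit_normal A x n).

Definition pderiv_mx k (F : 'rV[R]_2 -> 'rV[R]_k) u : 'M[R]_(2, k) :=
  \matrix_i pderiv i F u.

Lemma first_formE c u :
  first_form x c u = pderiv_mx (x \o param c) u *m (pderiv_mx (x \o param c) u)^T.
Proof.
by apply/matrixP => i j; rewrite !mxE dotE; apply: eq_bigr => k _; rewrite !mxE.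
Qed.

Lemma second_formE c u :
  second_form x n c u =
  - (pderiv_mx (x \o param c) u *m (pderiv_mx (n \o param c) u)^T).
Proof.
apply/matrixP => i j; rewrite !mxE dotE; congr (- _).
by apply: eq_bigr => k _; rewrite !mxE.
Qed.

Lemma first_form_sym c u : (first_form x c u)^T = first_form x c u.
Proof. by rewrite first_formE trmx_mul trmxK. Qed.

Lemma first_form_det_gt0 c u : charts A c -> cimg c u ->
  0 < \det (first_form x c u).
Proof.
move=> cA uc; have [xs _ dx_inj] := x_immersed.
have dX i : pderiv i (x \o param c) u = 'd (x \o param c) u (delta_mx 0 i).
  by rewrite /pderiv deriveE//; exact: smooth_on_differentiable (xs c cA) uc.
have d_eq0 v : 'd (x \o param c) u v = 0 -> v = 0.
  by move=> dv; apply: (dx_inj c u cA uc); rewrite dv linear0.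
have dot_gt0 (w : 'rV[R]_4) : w != 0 -> 0 < dot w w.
  by move=> w0; rewrite lt_def dot_ge0 dot_eq0 w0.
rewrite det_mx22 !mxE !dX.
set X0 := 'd _ _ _; set X1 := 'd _ _ _.
have X0n0 : X0 != 0.
  apply/eqP => /d_eq0 /matrixP/(_ 0 0); rewrite !mxE !eqxx => /eqP.
  by rewrite oner_eq0.
(* This vector is |X0|^2 times the part of X1 orthogonal to X0, and its squared length is |X0|^2
   times the Gram determinant. *)
have W0 : dot X0 X0 *: X1 + - (dot X0 X1 *: X0) != 0.
  rewrite -!linearZ -linearN -linearD; apply/eqP => /d_eq0 /matrixP/(_ 0 1).
  rewrite !mxE !eqxx /= mulr1 mulr0 oppr0 addr0 => /eqP.
  by rewrite dot_eq0 (negbTE X0n0).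
have := dot_gt0 _ W0; set W := (X in dot X X).
have -> : dot W W =
    dot X0 X0 * (dot X0 X0 * dot X1 X1 - dot X0 X1 * dot X1 X0).
  by rewrite /W !dot_lin (dotC X1 X0); ring.
by rewrite pmulr_rgt0// dot_gt0.
Qed.

Lemma first_form_unit c u : charts A c -> cimg c u ->
  first_form x c u \in unitmx.
Proof. by move=> cA uc; rewrite unitmxE unitfE gt_eqF// first_form_det_gt0. Qed.

Lemma pderiv_mx_transition k (f : M -> 'rV[R]_k) c c' u :
  smooth_map A f -> charts A c -> charts A c' -> cimg c u -> cdom c' (param c u) ->
  pderiv_mx (f \o param c) u =
  pderiv_mx (Defs.coord c' \o param c) u *m
  pderiv_mx (f \o param c') (Defs.coord c' (param c u)).
Proof.
move=> fs cA cA' uc uc'; pose phi := Defs.coord c' \o param c.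
have dphi : differentiable phi u.
  exact: (smooth_on_differentiable (transition_smooth cA cA') (conj uc uc')).
have df : differentiable (f \o param c') (phi u).
  exact: smooth_on_differentiable (fs c' cA') (coord_cimg uc').
(* The factorization through c' holds only where both charts are defined; a neighbourhood of u is
   enough for derivatives. *)
have near_dom : \forall v \near u, cdom c' (param c v).
  have cimg_u : nbhs u (cimg c) := open_nbhs_nbhs (conj (@cimg_open _ _ c) uc).
  have := (subspace_continuousP _ _).1 (@param_continuous _ _ c) u uc.
  move=> /(_ _ (open_nbhs_nbhs (conj (cdom_open c') uc'))).
  move=> H; have {}H : nbhs u (fun v => cimg c v -> cdom c' (param c v)) := H.
  by apply: filterS (filterI H cimg_u) => v [Hv cv]; exact: Hv.
have fE : \near u, (f \o param c) u = ((f \o param c') \o phi) u.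
  by apply: filterS near_dom => v vc'; rewrite /= coordK.
apply/row_matrixP => i; rewrite row_mul !rowK -/phi.
rewrite /pderiv (near_eq_derive _ fE) -/(pderiv i _ u) pderiv_comp//.
apply/rowP => l; rewrite summxE !mxE; apply: eq_bigr => k' _.
by rewrite !mxE.
Qed.

(** This replaces the preferred chart, which moves with the point, by one chart fixed throughout its
    image. Both forms change by congruence with the same Jacobian. *)
Lemma mean_curvature_chart c u : charts A c -> cimg c u ->
  mean_curvature A x n (param c u) =
  2^-1 * \tr (invmx (first_form x c u) *m second_form x n c u).
Proof.
move=> cA uc; rewrite /mean_curvature; set p := param c u; set c' := chart_at A p.
have cA' : charts A c' := chart_at_charts A p.
have pc' : cdom c' p := chart_at_cdom A p.
have [xs _ _] := x_immersed; have [ns _ _ _] := n_normal.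
have gu := first_form_unit cA uc.
rewrite !first_formE !second_formE in gu *.
rewrite (pderiv_mx_transition xs cA cA' uc pc') (pderiv_mx_transition ns cA cA' uc pc').
rewrite (pderiv_mx_transition xs cA cA' uc pc') in gu.
move: gu; move: (pderiv_mx (_ \o _) u) (pderiv_mx (x \o _) _) (pderiv_mx (n \o _) _).
move=> J X N; have JE B : J *m X *m (J *m B)^T = J *m (X *m B^T) *m J^T.
  by rewrite trmx_mul !mulmxA.
rewrite !JE => gu; congr (_ * _).
have trN (Z : 'M[R]_2) : \tr (- Z) = - \tr Z by rewrite raddfN.
by rewrite !mulmxN !trN (tr_invmx_congruence _ gu).
Qed.

End ChartInvariance.

(** * The Willmore expression in terms of inner products *)

Lemma tr_invmx22_mul (F : fieldType) (G K : 'M[F]_2) : G \in unitmx ->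
  \tr (invmx G *m K) =
  (G 1 1 * K 0 0 - G 0 1 * K 1 0 - G 1 0 * K 0 1 + G 0 0 * K 1 1) / \det G.
Proof.
move=> Gu; have [E00 E01 E10 E11] := invmx22E Gu.
by rewrite tr_mx22 !mulmx22E E00 E01 E10 E11; ring.
Qed.

(** For the shape operator K with trace 2k, the norm is the trace of (K - k)^2, and tr K^2 = 4 k^2 -
    2 det K. *)
Lemma tensor_normsq_tracefree (R : realType) (G h : 'M[R]_2) (k : R) :
  G \in unitmx -> \tr (invmx G *m h) = 2 * k ->
  tensor_normsq G (h - k *: G) = 2 * (k ^+ 2 - \det h / \det G).
Proof.
move=> Gu trK; set K := invmx G *m h in trK.
have -> : \det h / \det G = \det K by rewrite det_mulmx det_inv mulrC.
have KE : invmx G *m (h - k *: G) = K - k%:M.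
  by rewrite mulmxBr -scalemxAr mulVmx// scalemx1.
rewrite /tensor_normsq -mulmxA KE; clearbody K; rewrite tr_mx22 in trK.
have K11 : K 1 1 = 2 * k - K 0 0 by rewrite -trK addrC addKr.
by rewrite det_mx22 tr_mx22 !mulmx22E !mxE /= K11 ?mulr1n ?mulr0n; ring.
Qed.

(** The flux inside the Laplacian is rewritten as adjugate over root of the determinant, the form in
    which it is differentiated. *)
Lemma sqrt_det_invmx22 (R : realType) (G : 'M[R]_2) a b : 0 < \det G ->
  Num.sqrt (\det G) * (invmx G 0 0 * a + invmx G 0 1 * b) =
    (G 1 1 * a - G 0 1 * b) / Num.sqrt (\det G) /\
  Num.sqrt (\det G) * (invmx G 1 0 * a + invmx G 1 1 * b) =
    (G 0 0 * b - G 1 0 * a) / Num.sqrt (\det G).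
Proof.
move=> d0; have Gu : G \in unitmx by rewrite unitmxE unitfE gt_eqF.
have [-> -> -> ->] := invmx22E Gu.
have s0 : Num.sqrt (\det G) != 0 by rewrite gt_eqF// sqrtr_gt0.
have := sqr_sqrtr (ltW d0); move: s0; move: (Num.sqrt _) => r r0 <-.
by split; field.
Qed.

Section Gram.
Context {R : realType}.
Variables P Q : 'I_2 -> 'rV[R]_4.

Definition gram_mx : 'M[R]_2 := \matrix_(i, j) dot (P i) (P j).
Definition shape_mx : 'M[R]_2 := \matrix_(i, j) - dot (P i) (Q j).

Let gramE i j : gram_mx i j = dot (P i) (P j). Proof. by rewrite mxE. Qed.
Let shapeE i j : shape_mx i j = - dot (P i) (Q j). Proof. by rewrite mxE. Qed.

Lemma det_gram :
  \det gram_mx = dot (P 0) (P 0) * dot (P 1) (P 1) - dot (P 0) (P 1) ^+ 2.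
Proof. by rewrite det_mx22 !gramE expr2 (dotC (P 1) (P 0)). Qed.

Lemma gram_sqrt_det a b : 0 < \det gram_mx ->
  let d := dot (P 0) (P 0) * dot (P 1) (P 1) - dot (P 0) (P 1) ^+ 2 in
  Num.sqrt (\det gram_mx) * (invmx gram_mx 0 0 * a + invmx gram_mx 0 1 * b) =
    (dot (P 1) (P 1) * a - dot (P 0) (P 1) * b) / Num.sqrt d /\
  Num.sqrt (\det gram_mx) * (invmx gram_mx 1 0 * a + invmx gram_mx 1 1 * b) =
    (dot (P 0) (P 0) * b - dot (P 0) (P 1) * a) / Num.sqrt d.
Proof.
move=> d0 d; have := sqrt_det_invmx22 a b d0.
by rewrite !gramE (dotC (P 1) (P 0)) /d -det_gram.
Qed.

Variable k : R.
Hypothesis gram_unit : gram_mx \in unitmx.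
Hypothesis shape_sym : dot (P 1) (Q 0) = dot (P 0) (Q 1).

Lemma shape_mx_sym : shape_mx^T = shape_mx.
Proof. by apply: eq_mx22; rewrite !mxE// shape_sym. Qed.

Hypothesis tr_shape : \tr (invmx gram_mx *m shape_mx) = 2 * k.

Let d0 : \det gram_mx != 0. Proof. by rewrite -unitfE -unitmxE. Qed.

Lemma gram_mean : 2 * k *
    (dot (P 0) (P 0) * dot (P 1) (P 1) - dot (P 0) (P 1) ^+ 2) =
  - (dot (P 1) (P 1) * dot (P 0) (Q 0) - 2 * dot (P 0) (P 1) * dot (P 0) (Q 1)
     + dot (P 0) (P 0) * dot (P 1) (Q 1)).
Proof.
rewrite -tr_shape -det_gram tr_invmx22_mul// divfK// !gramE !shapeE.
by rewrite shape_sym (dotC (P 1) (P 0)); ring.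
Qed.

(** The last term of the hypothesis is - |II0|^2 H; adding the norm term of the Willmore expression
    leaves exactly a trace against g^{-1}. *)
Lemma gram_trace (S : 'I_2 -> 'rV[R]_4) (s : 'rV[R]_4) (K : 'I_2 -> R) (L : R) :
  let d := dot (P 0) (P 0) * dot (P 1) (P 1) - dot (P 0) (P 1) ^+ 2 in
  let Z j := k *: P j + Q j in
  (Num.sqrt d)^-1 * L =
  (dot (P 1) (P 1) * (dot (S 0) (Z 0) - dot s (P 0) * K 0)
   - dot (P 0) (P 1) * (dot (S 0) (Z 1) - dot s (P 0) * K 1
                        + (dot (S 1) (Z 0) - dot s (P 1) * K 0))
   + dot (P 0) (P 0) * (dot (S 1) (Z 1) - dot s (P 1) * K 1)) / d
  - 2 * (k ^+ 2 - (dot (P 0) (Q 0) * dot (P 1) (Q 1) - dot (P 0) (Q 1) ^+ 2) / d) * k ->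
  (Num.sqrt (\det gram_mx))^-1 * L
    + tensor_normsq gram_mx (shape_mx - k *: gram_mx) * k =
  \tr (invmx gram_mx *m
    \matrix_(i, j) (dot (S i) (k *: P j + Q j) - dot s (P i) * K j)).
Proof.
move=> d Z; rewrite det_gram -/d => ->.
rewrite tensor_normsq_tracefree// tr_invmx22_mul// det_gram -/d.
rewrite det_mx22 !gramE !shapeE shape_sym (dotC (P 1) (P 0)).
rewrite (mxE _ _ 0 0) (mxE _ _ 0 1) (mxE _ _ 1 0) (mxE _ _ 1 1) /Z.
move: d0; rewrite det_gram -/d => d0'.
by field.
Qed.

End Gram.

(* Subscripts 1 and 2 stand for the derivatives along e1 and e2; s is the space
   component of y*. *)
Section SurfacePatch.
Context {R : realType} {V : normedModType R}.
Variables (D : set V) (e1 e2 : V).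
Variables (X X1 X2 X11 X12 X22 N N1 N2 N11 N12 N22 s s1 s2 : V -> 'rV[R]_4).
Variables (H H1 H2 : V -> R).
Hypothesis D_open : open D.
Hypothesis dX : forall v, D v -> is_derive v e1 X (X1 v) /\ is_derive v e2 X (X2 v).
Hypothesis dX1 : forall v, D v ->
  is_derive v e1 X1 (X11 v) /\ is_derive v e2 X1 (X12 v).
Hypothesis dX2 : forall v, D v ->
  is_derive v e1 X2 (X12 v) /\ is_derive v e2 X2 (X22 v).
Hypothesis dN : forall v, D v -> is_derive v e1 N (N1 v) /\ is_derive v e2 N (N2 v).
Hypothesis dN1 : forall v, D v ->
  is_derive v e1 N1 (N11 v) /\ is_derive v e2 N1 (N12 v).
Hypothesis dN2 : forall v, D v ->
  is_derive v e1 N2 (N12 v) /\ is_derive v e2 N2 (N22 v).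
Hypothesis ds : forall v, D v -> is_derive v e1 s (s1 v) /\ is_derive v e2 s (s2 v).
Hypothesis dH : forall v, D v -> is_derive v e1 H (H1 v) /\ is_derive v e2 H (H2 v).
Hypothesis XX : forall v, D v -> dot (X v) (X v) = 1.
Hypothesis NN : forall v, D v -> dot (N v) (N v) = 1.
Hypothesis NX : forall v, D v -> dot (N v) (X v) = 0.
Hypothesis NX1 : forall v, D v -> dot (N v) (X1 v) = 0.
Hypothesis NX2 : forall v, D v -> dot (N v) (X2 v) = 0.

Let d v := dot (X1 v) (X1 v) * dot (X2 v) (X2 v) - dot (X1 v) (X2 v) ^+ 2.
Let Z1 v := H v *: X1 v + N1 v.
Let Z2 v := H v *: X2 v + N2 v.

Hypothesis d_gt0 : forall v, D v -> 0 < d v.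
Hypothesis H_mean : forall v, D v -> 2 * H v * d v =
  - (dot (X2 v) (X2 v) * dot (X1 v) (N1 v) - 2 * dot (X1 v) (X2 v) * dot (X1 v) (N2 v)
     + dot (X1 v) (X1 v) * dot (X2 v) (N2 v)).
Hypothesis H1_grad : forall v, D v -> H1 v = dot (s v) (Z1 v).
Hypothesis H2_grad : forall v, D v -> H2 v = dot (s v) (Z2 v).
Hypothesis sN : forall v, D v -> dot (s v) (N v) = H v.

Lemma dot_derive_eq (F G F' G' : V -> 'rV[R]_4) v e dF dG dF' dG' : D v ->
  is_derive v e F dF -> is_derive v e G dG ->
  is_derive v e F' dF' -> is_derive v e G' dG' ->
  (forall w, D w -> dot (F w) (G w) = dot (F' w) (G' w)) ->
  dot dF (G v) + dot (F v) dG = dot dF' (G' v) + dot (F' v) dG'.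
Proof.
move=> Dv Fv Gv F'v G'v FG; apply: (is_derive_unique_on D_open Dv FG);
  exact: is_derive_dot.
Qed.

Lemma dot_derive_const (F G : V -> 'rV[R]_4) a v e dF dG : D v ->
  is_derive v e F dF -> is_derive v e G dG ->
  (forall w, D w -> dot (F w) (G w) = a) ->
  dot dF (G v) = - dot (F v) dG.
Proof.
move=> Dv Fv Gv FG; apply/eqP; rewrite -addr_eq0; apply/eqP.
exact: (is_derive_unique_on D_open Dv FG (is_derive_dot Fv Gv) (is_derive_cst _ _ _)).
Qed.

Lemma dot_derive_self (F : V -> 'rV[R]_4) a v e dF : D v -> is_derive v e F dF ->
  (forall w, D w -> dot (F w) (F w) = a) -> dot dF (F v) = 0.
Proof.
by move=> Dv Fv /(dot_derive_const Dv Fv Fv); rewrite (dotC (F v)); lra.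
Qed.

Let X1X v : D v -> dot (X1 v) (X v) = 0.
Proof. by move=> Dv; exact: dot_derive_self Dv (dX Dv).1 XX. Qed.

Let X2X v : D v -> dot (X2 v) (X v) = 0.
Proof. by move=> Dv; exact: dot_derive_self Dv (dX Dv).2 XX. Qed.

Let N1N v : D v -> dot (N1 v) (N v) = 0.
Proof. by move=> Dv; exact: dot_derive_self Dv (dN Dv).1 NN. Qed.

Let N2N v : D v -> dot (N2 v) (N v) = 0.
Proof. by move=> Dv; exact: dot_derive_self Dv (dN Dv).2 NN. Qed.

Let N1X v : D v -> dot (N1 v) (X v) = 0.
Proof.
by move=> Dv; rewrite (dot_derive_const Dv (dN Dv).1 (dX Dv).1 NX) NX1// oppr0.
Qed.

Let N2X v : D v -> dot (N2 v) (X v) = 0.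
Proof.
by move=> Dv; rewrite (dot_derive_const Dv (dN Dv).2 (dX Dv).2 NX) NX2// oppr0.
Qed.

Lemma patch_shape_sym v : D v -> dot (X2 v) (N1 v) = dot (X1 v) (N2 v).
Proof.
move=> Dv; rewrite (dotC (X2 v)) (dotC (X1 v)).
rewrite (dot_derive_const Dv (dN Dv).1 (dX2 Dv).1 NX2).
by rewrite (dot_derive_const Dv (dN Dv).2 (dX1 Dv).2 NX1).
Qed.

Lemma patch_frame v : D v -> is_frame (X v) (N v) (X1 v) (X2 v).
Proof.
move=> Dv; split; [exact: XX|exact: NN|exact: NX|split].
all: by [exact: X1X|exact: X2X|exact: NX1|exact: NX2|exact/lt0r_neq0/d_gt0].
Qed.

Let dd v : D v ->
  is_derive v e1 d
    (2 * dot (X11 v) (X1 v) * dot (X2 v) (X2 v)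
     + dot (X1 v) (X1 v) * (2 * dot (X12 v) (X2 v))
     - 2 * dot (X1 v) (X2 v) * (dot (X11 v) (X2 v) + dot (X12 v) (X1 v))) /\
  is_derive v e2 d
    (2 * dot (X12 v) (X1 v) * dot (X2 v) (X2 v)
     + dot (X1 v) (X1 v) * (2 * dot (X22 v) (X2 v))
     - 2 * dot (X1 v) (X2 v) * (dot (X12 v) (X2 v) + dot (X22 v) (X1 v))).
Proof.
move=> Dv; have [a1 a2] := dX1 Dv; have [b1 b2] := dX2 Dv.
split.
  apply: is_derive_eq (is_derive_sub_fun (is_derive_mul_fun (is_derive_dot a1 a1)
    (is_derive_dot b1 b1)) (is_derive_sqr_fun (is_derive_dot a1 b1))) _.
  by rewrite !(dotC _ (X12 v)) !(dotC _ (X11 v)); ring.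
apply: is_derive_eq (is_derive_sub_fun (is_derive_mul_fun (is_derive_dot a2 a2)
  (is_derive_dot b2 b2)) (is_derive_sqr_fun (is_derive_dot a2 b2))) _.
by rewrite !(dotC _ (X12 v)) !(dotC _ (X22 v)); ring.
Qed.

Let dZ1 v : D v ->
  is_derive v e1 Z1 (H1 v *: X1 v + H v *: X11 v + N11 v) /\
  is_derive v e2 Z1 (H2 v *: X1 v + H v *: X12 v + N12 v).
Proof.
move=> Dv; have [a1 a2] := dX1 Dv; have [b1 b2] := dN1 Dv; have [c1 c2] := dH Dv.
split; [exact: is_deriveD (is_derive_scale c1 a1) b1|
        exact: is_deriveD (is_derive_scale c2 a2) b2].
Qed.

Let dZ2 v : D v ->
  is_derive v e1 Z2 (H1 v *: X2 v + H v *: X12 v + N12 v) /\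
  is_derive v e2 Z2 (H2 v *: X2 v + H v *: X22 v + N22 v).
Proof.
move=> Dv; have [a1 a2] := dX2 Dv; have [b1 b2] := dN2 Dv; have [c1 c2] := dH Dv.
split; [exact: is_deriveD (is_derive_scale c1 a1) b1|
        exact: is_deriveD (is_derive_scale c2 a2) b2].
Qed.

(** The second derivatives of H come from its gradient relation s.Z_j, which already expresses H_j
    by differentiable data. *)
Let dH1 v : D v ->
  is_derive v e1 H1
    (dot (s1 v) (Z1 v) + dot (s v) (H1 v *: X1 v + H v *: X11 v + N11 v)) /\
  is_derive v e2 H1
    (dot (s2 v) (Z1 v) + dot (s v) (H2 v *: X1 v + H v *: X12 v + N12 v)).
Proof.
move=> Dv; have [a1 a2] := ds Dv; have [b1 b2] := dZ1 Dv.
have E w : D w -> dot (s w) (Z1 w) = H1 w by move=> /H1_grad ->.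
split; [exact: is_derive_on D_open Dv E (is_derive_dot a1 b1)|
        exact: is_derive_on D_open Dv E (is_derive_dot a2 b2)].
Qed.

Let dH2 v : D v ->
  is_derive v e1 H2
    (dot (s1 v) (Z2 v) + dot (s v) (H1 v *: X2 v + H v *: X12 v + N12 v)) /\
  is_derive v e2 H2
    (dot (s2 v) (Z2 v) + dot (s v) (H2 v *: X2 v + H v *: X22 v + N22 v)).
Proof.
move=> Dv; have [a1 a2] := ds Dv; have [b1 b2] := dZ2 Dv.
have E w : D w -> dot (s w) (Z2 w) = H2 w by move=> /H2_grad ->.
split; [exact: is_derive_on D_open Dv E (is_derive_dot a1 b1)|
        exact: is_derive_on D_open Dv E (is_derive_dot a2 b2)].
Qed.

(** Besides s.Z_j, a second expression for the derivative of H is required: differentiating the mean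
    curvature formula, cleared of denominators, brings in the derivatives of II on which Codazzi
    acts. *)
Let dH_mean v e dd' dH' (X1' X2' N1' N2' : 'rV[R]_4) : D v ->
  is_derive v e d dd' -> is_derive v e H dH' ->
  is_derive v e X1 X1' -> is_derive v e X2 X2' ->
  is_derive v e N1 N1' -> is_derive v e N2 N2' ->
  2 * (dH' * d v + H v * dd') =
  - ((2 * dot X2' (X2 v)) * dot (X1 v) (N1 v)
     + dot (X2 v) (X2 v) * (dot X1' (N1 v) + dot (X1 v) N1')
     - 2 * ((dot X1' (X2 v) + dot X2' (X1 v)) * dot (X1 v) (N2 v)
            + dot (X1 v) (X2 v) * (dot X1' (N2 v) + dot (X1 v) N2'))
     + ((2 * dot X1' (X1 v)) * dot (X2 v) (N2 v)
        + dot (X1 v) (X1 v) * (dot X2' (N2 v) + dot (X2 v) N2'))).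
Proof.
move=> Dv dv Hv x1 x2 n1 n2.
have c2 : is_derive v e (fun=> 2 : R) 0 := is_derive_cst _ _ _.
have L := is_derive_mul_fun (is_derive_mul_fun c2 Hv) dv.
have R1 := is_derive_mul_fun (is_derive_dot x2 x2) (is_derive_dot x1 n1).
have R2 := is_derive_mul_fun (is_derive_mul_fun c2 (is_derive_dot x1 x2))
  (is_derive_dot x1 n2).
have R3 := is_derive_mul_fun (is_derive_dot x1 x1) (is_derive_dot x2 n2).
have := is_derive_unique_on D_open Dv H_mean L
  (is_deriveN (is_deriveD (is_derive_sub_fun R1 R2) R3)).
rewrite !mul0r !add0r => E; rewrite mulrDr mulrA (mulrA 2 (H v)) E.
by rewrite !(dotC (X1 v) X1') !(dotC (X2 v) X2') !(dotC (X1 v) X2'); ring.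
Qed.

Lemma patch_divergence u : D u -> exists F1 F2 : R, [/\
  is_derive u e1 (fun v => (dot (X2 v) (X2 v) * H1 v - dot (X1 v) (X2 v) * H2 v)
                           / Num.sqrt (d v)) F1,
  is_derive u e2 (fun v => (dot (X1 v) (X1 v) * H2 v - dot (X1 v) (X2 v) * H1 v)
                           / Num.sqrt (d v)) F2 &
  (Num.sqrt (d u))^-1 * (F1 + F2) =
  (dot (X2 u) (X2 u) * (dot (s1 u) (Z1 u) - dot (s u) (X1 u) * H1 u)
   - dot (X1 u) (X2 u) * (dot (s1 u) (Z2 u) - dot (s u) (X1 u) * H2 u
                          + (dot (s2 u) (Z1 u) - dot (s u) (X2 u) * H1 u))
   + dot (X1 u) (X1 u) * (dot (s2 u) (Z2 u) - dot (s u) (X2 u) * H2 u)) / d u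
  - 2 * (H u ^+ 2 - (dot (X1 u) (N1 u) * dot (X2 u) (N2 u)
                     - dot (X1 u) (N2 u) ^+ 2) / d u) * H u].
Proof.
move=> Du; have [x11 x12] := dX1 Du; have [x21 x22] := dX2 Du.
have [h11 h12] := dH1 Du; have [h21 h22] := dH2 Du; have [d1 d2] := dd Du.
have f1 := is_derive_div_sqrt (d_gt0 Du) (is_derive_sub_fun
  (is_derive_mul_fun (is_derive_dot x21 x21) h11)
  (is_derive_mul_fun (is_derive_dot x11 x21) h21)) d1.
have f2 := is_derive_div_sqrt (d_gt0 Du) (is_derive_sub_fun
  (is_derive_mul_fun (is_derive_dot x12 x12) h22)
  (is_derive_mul_fun (is_derive_dot x12 x22) h12)) d2.
eexists; eexists; split; [exact: f1|exact: f2|].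
rewrite -mulrDl mulrCA -invfM -expr2 sqr_sqrtr; last exact/ltW/d_gt0.
have d0 := lt0r_neq0 (d_gt0 Du).
have [n11 n12] := dN1 Du; have [n21 n22] := dN2 Du.
have [x1 x2] := dX Du; have [n1 n2] := dN Du; have [H1' H2'] := dH Du.
have X1N w : D w -> dot (X1 w) (N w) = 0 by move=> Dw; rewrite dotC NX1.
have X2N w : D w -> dot (X2 w) (N w) = 0 by move=> Dw; rewrite dotC NX2.
have sym w : D w -> dot (X1 w) (N2 w) = dot (X2 w) (N1 w).
  by move=> Dw; rewrite patch_shape_sym.
have N11X := dot_derive_const Du n11 x1 N1X; rewrite (dotC (N1 u)) in N11X.
have N12X := dot_derive_const Du n21 x1 N2X; rewrite (dotC (N2 u)) in N12X.
have N22X := dot_derive_const Du n22 x2 N2X; rewrite (dotC (N2 u)) in N22X.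
have U := dot_grad_divergence (patch_frame Du) (N1X Du) (N2X Du) (N1N Du) (N2N Du)
  (patch_shape_sym Du) (dot_derive_const Du x11 x1 X1X)
  (dot_derive_const Du x12 x2 X1X) (dot_derive_const Du x22 x2 X2X)
  (dot_derive_const Du x11 n1 X1N) (dot_derive_const Du x12 n2 X1N)
  (dot_derive_const Du x22 n2 X2N) N11X N12X N22X
  (dot_derive_const Du n11 n1 N1N) (dot_derive_const Du n12 n2 N1N)
  (dot_derive_const Du n22 n2 N2N) (dot_derive_eq Du x11 n21 x21 n11 sym)
  (dot_derive_eq Du x12 n22 x22 n12 sym) (H_mean Du)
  (dH_mean Du d1 H1' x11 x21 n11 n21) (dH_mean Du d2 H2' x12 x22 n12 n22) (s u).
rewrite sN// in U.
have {U} := congr1 (fun z => z / d u) U; rewrite /grad_divergence !dot_lin -/(d u) => U.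
(* The difference of the two sides of the goal is, as a rational expression, the difference of the
   two sides of [U]. *)
apply/eqP; rewrite -subr_eq0; apply/eqP; move/eqP: U; rewrite -subr_eq0 => /eqP U.
rewrite -[RHS]U (H1_grad Du) (H2_grad Du) !dot_lin.
rewrite !(dotC _ (X12 u)) !(dotC _ (X11 u)) !(dotC _ (X22 u)).
by field.
Qed.

End SurfacePatch.

(* P, Q and S stand for the derivatives of x, n and of the space component s of y*;
   the time components of y* and of its derivatives are 1 + s.x and
   S_i.x + s.P_i. *)
Section DualFrame.
Context {R : realType}.
Variables (x n s : 'rV[R]_4) (P Q S : 'I_2 -> 'rV[R]_4) (k : R).
Hypothesis frame : is_frame x n (P 0) (P 1).
Hypotheses (Qx : forall i, dot (Q i) x = 0) (Qn : forall i, dot (Q i) n = 0).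
Hypothesis sn : dot s n = k.
Hypothesis Sn : forall i, dot (S i) n = k * dot s (P i).
Hypothesis s_null : dot s s = (1 + dot s x) ^+ 2.
Hypothesis S_null :
  forall i, dot (S i) s = (dot (S i) x + dot s (P i)) * (1 + dot s x).

Let G := gram_mx P.
Let A := shape_mx P Q - k *: G.

(* dual_mx i j = <d_i y*, d_j y + <y*, d_j y> y> *)
Definition dual_mx : 'M[R]_2 :=
  \matrix_(i, j) (dot (S i) (P j) - dot s (P i) * dot s (P j)).

Let detG : \det G != 0.
Proof. by rewrite det_gram; case: frame => _ _ _ []. Qed.

Let G_unit : G \in unitmx. Proof. by rewrite unitmxE unitfE. Qed.

(** Let e_j = d_j y + <y*, d_j y> y, which is orthogonal to y, y* and xi. As d_i y* is orthogonal to
    y* and xi, it is a multiple of y* plus a combination of the e_k with coefficients P g^{-1}. The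
    y*-part is null and orthogonal to the e_k, so it does not contribute. *)
Lemma dual_metric i j :
  - ((dot (S i) x + dot s (P i)) * (dot (S j) x + dot s (P j))) + dot (S i) (S j) =
  (dual_mx *m invmx G *m dual_mx^T) i j.
Proof.
have DG := det_gram P; have d0 := detG; rewrite /G DG in d0.
(* In both null relations the quadratic terms in the x-components cancel after the frame expansion,
   so they can be solved linearly for S_l.x and s.x. *)
have Sx l : dot (S l) x = - dot s (P l) * (1 + dot s x) + k ^+ 2 * dot s (P l) +
   (dot (P 1) (P 1) * (dot (S l) (P 0) * dot s (P 0))
    - dot (P 0) (P 1) * (dot (S l) (P 0) * dot s (P 1) + dot (S l) (P 1) * dot s (P 0))
    + dot (P 0) (P 0) * (dot (S l) (P 1) * dot s (P 1))) /
   (dot (P 0) (P 0) * dot (P 1) (P 1) - dot (P 0) (P 1) ^+ 2).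
  have := S_null l; rewrite (dot_frame _ _ frame) Sn sn => E.
  apply/eqP; rewrite -subr_eq0; apply/eqP; move/eqP: E.
  by rewrite eq_sym -subr_eq0 => /eqP <-; ring.
have sx : dot s x = (k ^+ 2 - 1 +
   (dot (P 1) (P 1) * (dot s (P 0) * dot s (P 0))
    - dot (P 0) (P 1) * (dot s (P 0) * dot s (P 1) + dot s (P 1) * dot s (P 0))
    + dot (P 0) (P 0) * (dot s (P 1) * dot s (P 1))) /
   (dot (P 0) (P 0) * dot (P 1) (P 1) - dot (P 0) (P 1) ^+ 2)) / 2.
  have := s_null; rewrite (dot_frame _ _ frame) sn => E.
  apply: (mulIf (x := 2)); rewrite ?pnatr_eq0// divfK ?pnatr_eq0//.
  apply/eqP; rewrite -subr_eq0; apply/eqP; move/eqP: E.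
  by rewrite eq_sym -subr_eq0 => /eqP <-; ring.
have [E00 E01 E10 E11] := invmx22E G_unit.
rewrite !mulmx22E E00 E01 E10 E11 DG ![G _ _]mxE ![dual_mx^T _ _]mxE ![dual_mx _ _]mxE.
rewrite (dot_frame (S i) (S j) frame) !Sn !Sx sx (dotC (P 1) (P 0)).
by field.
Qed.

(** The vector d_j xi is orthogonal to y, y* and xi, hence a combination of the projected tangents
    of [dual_metric], with coefficients - g^{-1} II0. *)
Lemma dual_second i j :
  dot (S i) (k *: P j + Q j) - dot s (P i) * dot s (k *: P j + Q j) =
  - (dual_mx *m invmx G *m A) i j.
Proof.
have DG := det_gram P; have d0 := detG; rewrite /G DG in d0.
have [E00 E01 E10 E11] := invmx22E G_unit.
have [_ _ _ [Px0 Px1 nP0 nP1 _]] := frame.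
set Z := k *: P j + Q j.
have Zx : dot Z x = 0.
  by rewrite /Z !dot_lin Qx; case: (ord2_case j) => ->; rewrite ?Px0 ?Px1 mulr0 addr0.
have Zn : dot Z n = 0.
  rewrite /Z !dot_lin Qn !(dotC _ n).
  by case: (ord2_case j) => ->; rewrite ?nP0 ?nP1 mulr0 addr0.
have AE l : A l j = - dot Z (P l).
  by rewrite !mxE /Z !dot_lin !(dotC _ (P l)); ring.
rewrite !mulmx22E E00 E01 E10 E11 DG ![G _ _]mxE ![dual_mx _ _]mxE !AE.
rewrite (dot_frame (S i) Z frame) (dot_frame s Z frame) Zx Zn (dotC (P 1) (P 0)).
by field.
Qed.

End DualFrame.

(** * Minkowski products and coordinates on R x M *)

Section MinkowskiProduct.
Context {R : realType}.
Implicit Types u v w : 'rV[R]_(1 + 4).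

Lemma minkDr u v w : mink w (u + v) = mink w u + mink w v.
Proof. by rewrite minkC minkDl !(minkC w). Qed.

Lemma minkZr a u w : mink w (a *: u) = a * mink w u.
Proof. by rewrite minkC minkZl minkC. Qed.

Definition mink_lin := (@minkDl R, minkDr, @minkZl R, minkZr).

Lemma mink_scalar_row u a (v : 'rV[R]_4) :
  mink u (row_mx a%:M v) = - (lsubmx u 0 0 * a) + dot (rsubmx u) v.
Proof.
have -> : a = (a%:M : 'M[R]_1) 0 0 by rewrite mxE eqxx.
by rewrite -[u in LHS]hsubmxK mink_row -mx11_scalar.
Qed.

End MinkowskiProduct.

Section ProductChart.
Context {R : realType} {n : nat} {W : normedModType R}.
Implicit Types w : 'rV[R]_(1 + n).

Lemma lsubmx_shift_time h w :
  lsubmx (h *: delta_mx 0 (lshift n 0) + w) 0 0 = h + lsubmx w 0 0.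
Proof. by rewrite !mxE !eqxx mulr1. Qed.

Lemma rsubmx_shift_time h w :
  rsubmx (h *: delta_mx 0 (lshift n 0) + w) = rsubmx w.
Proof.
by apply/rowP => j; rewrite !mxE eq_sym eq_lrshift andbF mulr0 add0r.
Qed.

Lemma lsubmx_shift_space h i w :
  lsubmx (h *: delta_mx 0 (rshift 1 i) + w) = lsubmx w.
Proof. by apply/rowP => j; rewrite !mxE eq_lrshift andbF mulr0 add0r. Qed.

Lemma rsubmx_shift_space h i w :
  rsubmx (h *: delta_mx 0 (rshift 1 i) + w) = h *: delta_mx 0 i + rsubmx w.
Proof. by apply/rowP => j; rewrite !mxE (inj_eq (@rshift_inj _ _)). Qed.

Lemma is_derive_time (F : R -> 'rV[R]_n -> W) w dF :
  is_derive (lsubmx w 0 0) 1 (F ^~ (rsubmx w)) dF ->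
  is_derive w (delta_mx 0 (lshift n 0)) (fun v => F (lsubmx v 0 0) (rsubmx v)) dF.
Proof.
apply: is_derive_line => h.
by rewrite lsubmx_shift_time rsubmx_shift_time [h *: (1 : R^o)]mulr1.
Qed.

Lemma is_derive_space (F : R -> 'rV[R]_n -> W) i w dF :
  is_derive (rsubmx w) (delta_mx 0 i) (F (lsubmx w 0 0)) dF ->
  is_derive w (delta_mx 0 (rshift 1 i)) (fun v => F (lsubmx v 0 0) (rsubmx v)) dF.
Proof.
by apply: is_derive_line => h; rewrite lsubmx_shift_space rsubmx_shift_space.
Qed.

End ProductChart.

Section RuledProducts.
Context {R : realType}.
Implicit Types y z e f v : 'rV[R]_(1 + 4).

(** With c = e^t, y and z = y*, this is d_t x^+; with e = d_i y and f = d_i y*, [ruled_space] is d_i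
    x^+. *)
Definition ruled_time (c : R) y z := (Num.sqrt 2)^-1 *: (c *: y + (- c^-1) *: z).
Definition ruled_space (c : R) e f := (Num.sqrt 2)^-1 *: (c *: e + c^-1 *: f).

Let sqrt2V (a : R) : (Num.sqrt 2)^-1 * ((Num.sqrt 2)^-1 * a) = a / 2.
Proof. by rewrite mulrA -invfM -expr2 sqr_sqrtr// mulrC. Qed.

Lemma mink_ruled_time c y z : c != 0 ->
  mink y y = 0 -> mink z z = 0 -> mink z y = - 1 ->
  mink (ruled_time c y z) (ruled_time c y z) = 1.
Proof.
move=> c0 yy zz zy; have yz : mink y z = -1 by rewrite minkC.
by rewrite /ruled_time minkZl minkZr sqrt2V !mink_lin yy zz zy yz; field.
Qed.

Lemma mink_ruled_time_space c y z e f a : c != 0 ->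
  mink y e = 0 -> mink z f = 0 -> mink z e = a -> mink f y = - a ->
  mink (ruled_time c y z) (ruled_space c e f) = - a.
Proof.
move=> c0 ye zf ze fy; have yf : mink y f = - a by rewrite minkC.
by rewrite /ruled_time minkZl minkZr sqrt2V !mink_lin ye zf ze yf; field.
Qed.

Lemma mink_ruled_space c e f e' f' : c != 0 ->
  mink (ruled_space c e f) (ruled_space c e' f') =
  2^-1 * (c ^+ 2 * mink e e' + (mink f e' + mink f' e) + c ^- 2 * mink f f').
Proof.
move=> c0; rewrite (minkC f' e).
by rewrite /ruled_time minkZl minkZr sqrt2V !mink_lin; field.
Qed.

Lemma mink_ruled_time_normal c y z v : mink y v = 0 -> mink z v = 0 ->
  mink (ruled_time c y z) v = 0.
Proof. by move=> yv zv; rewrite minkZl !mink_lin yv zv !mulr0 addr0 mulr0. Qed.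

Lemma mink_ruled_space_normal c e f v :
  - mink (ruled_space c e f) v =
  (Num.sqrt 2)^-1 * (c * (- mink e v) + c^-1 * (- mink f v)).
Proof. by rewrite minkZl !mink_lin; ring. Qed.

End RuledProducts.

Lemma block_mx_entries (R : Type) (n : nat) (M : 'M[R]_(1 + n))
    (a : 'M[R]_1) (b : 'rV[R]_n) (d : 'cV[R]_n) (e : 'M[R]_n) :
  M (lshift n 0) (lshift n 0) = a 0 0 ->
  (forall j, M (lshift n 0) (rshift 1 j) = b 0 j) ->
  (forall i, M (rshift 1 i) (lshift n 0) = d i 0) ->
  (forall i j, M (rshift 1 i) (rshift 1 j) = e i j) ->
  M = block_mx a b d e.
Proof.
move=> Ma Mb Md Me; rewrite -[M]submxK; congr block_mx; apply/matrixP => i j;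
  rewrite !mxE ?ord1 //.
Qed.

Lemma mx_quadratic_entries (R : comPzRingType) m (G P Q : 'M[R]_m) (b : 'rV[R]_m)
    (r a e : R) i j :
  (r *: (a *: G + (P + P^T) + e *: Q) + b^T *m b) i j =
  r * (a * G i j + (P i j + P j i) + e * Q i j) + b 0 i * b 0 j.
Proof. by rewrite !mxE big_ord1 !mxE. Qed.

(** The product <d_i y*, d_j y> is P_ij + (s.x_i)(s.x_j). Half of the two corrections is the product
    of the mixed entries <d_t x^+, d_i x^+> and <d_t x^+, d_j x^+>, precisely what the Schur
    complement removes. *)
Lemma complete_square (R : realType) (k l a a' p q p' q' e e' w1 w2 v1 v2 : R) :
  a = a' -> e = e' -> p' = p - w1 * w2 -> q' = q - w2 * w1 ->
  v1 = - w1 -> v2 = - w2 ->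
  2^-1 * (k * a + (p + q) + l * e) = 2^-1 * (k * a' + (p' + q') + l * e') + v1 * v2.
Proof. by move=> -> -> -> -> -> ->; field. Qed.

(** * The surface, its dual lift and the Willmore trace in one chart *)

Section LocalGeometry.
Context {R : realType} {M : topologicalType} (A : smooth_atlas R M).
Context (x n : M -> 'rV[R]_4) (ys : M -> 'rV[R]_(1 + 4)).
Hypotheses (x_immersed : immersed_in_S3 A x) (n_normal : unit_normal A x n).
Hypothesis ys_dual : dual_light_lift A x n ys.
Variable c : chart R M.
Hypothesis cA : charts A c.

Let X := x \o param c.
Let N := n \o param c.
Let Y := ys \o param c.
Let s u := rsubmx (Y u).
Let H := mean_curvature A x n \o param c.
Let D := cimg c.
Let xi := conformal_gauss A x n \o param c.

Let D_open : open D. Proof. exact: cimg_open. Qed.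

Let XX v : D v -> dot (X v) (X v) = 1.
Proof. by case: x_immersed => _ xx _ _; exact: xx. Qed.

Let NN v : D v -> dot (N v) (N v) = 1.
Proof. by case: n_normal => _ nn _ _ _; exact: nn. Qed.

Let NX v : D v -> dot (N v) (X v) = 0.
Proof. by case: n_normal => _ _ nx _ _; exact: nx. Qed.

Let NXi i v : D v -> dot (N v) (pderiv i X v) = 0.
Proof. by move=> Dv; case: n_normal => _ _ _ nxi; exact: nxi. Qed.

Let Xs : smooth_on D X. Proof. by case: x_immersed => xs _ _; exact: xs. Qed.
Let Ns : smooth_on D N. Proof. by case: n_normal => ns _ _ _; exact: ns. Qed.
Let Ys : smooth_on D Y. Proof. by case: ys_dual => yss _ _ _ _; exact: yss. Qed.

Let ys_time u : D u -> lsubmx (Y u) 0 0 = 1 + dot (s u) (X u).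
Proof.
move=> Du; case: ys_dual => _ _ /(_ (param c u)) + _ _.
rewrite mink_scalar_row mulr1 -[ys _]/(Y u) -[x _]/(X u) -/(s u) => E.
by rewrite -[1]opprK -E; ring.
Qed.

Lemma conformal_gaussE p :
  conformal_gauss A x n p =
  row_mx (mean_curvature A x n p)%:M (mean_curvature A x n p *: x p + n p).
Proof.
by rewrite /conformal_gauss /light_lift scale_row_mx add_row_mx addr0 scalemx1.
Qed.

(** In <y*, xi> = 0 the terms H s.x from the time and space parts cancel. *)
Let dot_s_N u : D u -> dot (s u) (N u) = H u.
Proof.
move=> Du; case: ys_dual => _ _ _ /(_ (param c u)) + _.
rewrite conformal_gaussE mink_scalar_row -[ys _]/(Y u).
rewrite ys_time// -/(s u) dotDr dotZr -[x _]/(X u) -[n _]/(N u).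
rewrite -[mean_curvature _ _ _ _]/(H u) => E.
by apply/eqP; rewrite -subr_eq0; apply/eqP; rewrite -E; ring.
Qed.

Let ds i u : D u -> is_derive u (delta_mx 0 i) s (rsubmx (pderiv i Y u)).
Proof. by move=> Du; apply: is_derive_rsubmx; exact: smooth_on_is_derive Ys Du. Qed.

(** Differentiability of H is inherited from s.n. *)
Let dH i u : D u -> is_derive u (delta_mx 0 i) H (pderiv i H u).
Proof.
move=> Du; have := is_derive_on D_open Du dot_s_N
  (is_derive_dot (ds i Du) (smooth_on_is_derive i Ns Du)).
by move=> [Hd _]; split.
Qed.

Lemma pderiv_conformal_gauss i u : D u ->
  is_derive u (delta_mx 0 i) xi
    (row_mx (pderiv i H u)%:M
       (pderiv i H u *: X u + (H u *: pderiv i X u + pderiv i N u))).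
Proof.
move=> Du.
have -> : xi = fun v => row_mx (H v *: 1%:M) (H v *: X v + N v).
  by apply/funext => v; rewrite /xi /= conformal_gaussE scalemx1.
rewrite addrA; apply: is_derive_row_mx.
  apply: is_derive_eq (is_derive_scale (dH i Du) (is_derive_cst _ _ _)) _.
  by rewrite scaler0 addr0 scalemx1.
exact: is_deriveD (is_derive_scale (dH i Du) (smooth_on_is_derive i Xs Du))
  (smooth_on_is_derive i Ns Du).
Qed.

Let H_grad i u : D u ->
  pderiv i H u = dot (s u) (H u *: pderiv i X u + pderiv i N u).
Proof.
move=> Du; case: ys_dual => _ _ _ _ /(_ c u i cA Du).
rewrite -/xi [pderiv i xi u](derive_val (is_derive := pderiv_conformal_gauss i Du)).
rewrite mink_scalar_row -[ys _]/(Y u) ys_time// -/(s u) dotDr dotZr => E.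
by apply/eqP; rewrite -subr_eq0; apply/eqP; rewrite -[RHS]oppr0 -E; ring.
Qed.

Let g := first_form x c.
Let h := second_form x n c.
Let B u : 'M[R]_2 := \matrix_(i, j) mink (pderiv i Y u) (pderiv j xi u).

Let g_unit u : D u -> g u \in unitmx.
Proof. by move=> Du; exact: (first_form_unit x_immersed cA Du). Qed.

Let det_gt0 u : D u -> 0 < \det (g u).
Proof. by move=> Du; exact: (first_form_det_gt0 x_immersed cA Du). Qed.

Let det_gram_gt0 u : D u -> 0 < dot (pderiv 0 X u) (pderiv 0 X u) *
    dot (pderiv 1 X u) (pderiv 1 X u) - dot (pderiv 0 X u) (pderiv 1 X u) ^+ 2.
Proof.
by move=> /det_gt0; rewrite (det_gram (fun i => pderiv i X u)).
Qed.

Let d1 (F : 'rV[R]_2 -> 'rV[R]_4) : smooth_on D F -> forall v, D v ->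
  is_derive v (delta_mx 0 0) F (pderiv 0 F v) /\
  is_derive v (delta_mx 0 1) F (pderiv 1 F v).
Proof. by move=> Fs v Dv; split; exact: smooth_on_is_derive Fs Dv. Qed.

(** Schwarz is used here, so that one function serves as mixed derivative for both first partials,
    as [patch_divergence] expects. *)
Let d2 (F : 'rV[R]_2 -> 'rV[R]_4) : smooth_on D F -> forall v, D v ->
  is_derive v (delta_mx 0 0) (pderiv 1 F) (pderiv 1 (pderiv 0 F) v) /\
  is_derive v (delta_mx 0 1) (pderiv 1 F) (pderiv 1 (pderiv 1 F) v).
Proof.
move=> Fs v Dv; have [E0 E1] := d1 (smooth_on_pderiv 1 Fs) Dv.
exact: conj (is_derive_eq E0 (pderiv_comm 0 1 D_open Fs Dv)) E1.
Qed.

Let trK u : D u -> \tr (invmx (g u) *m h u) = 2 * H u.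
Proof.
move=> Du; rewrite /H /= (mean_curvature_chart x_immersed n_normal cA Du).
by rewrite mulVKf// pnatr_eq0.
Qed.

Let sym u : D u -> dot (pderiv 1 X u) (pderiv 0 N u) =
                  dot (pderiv 0 X u) (pderiv 1 N u).
Proof.
exact: (patch_shape_sym D_open (d1 (smooth_on_pderiv 0 Xs)) (d2 Xs) (d1 Ns) (NXi 0)
  (NXi 1)).
Qed.

Let H_mean u : D u -> 2 * H u *
    (dot (pderiv 0 X u) (pderiv 0 X u) * dot (pderiv 1 X u) (pderiv 1 X u)
     - dot (pderiv 0 X u) (pderiv 1 X u) ^+ 2) =
  - (dot (pderiv 1 X u) (pderiv 1 X u) * dot (pderiv 0 X u) (pderiv 0 N u)
     - 2 * dot (pderiv 0 X u) (pderiv 1 X u) * dot (pderiv 0 X u) (pderiv 1 N u)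
     + dot (pderiv 0 X u) (pderiv 0 X u) * dot (pderiv 1 X u) (pderiv 1 N u)).
Proof.
by move=> Du; exact: (@gram_mean _ (fun i => pderiv i X u) (fun i => pderiv i N u)
  _ (g_unit Du) (sym Du) (trK Du)).
Qed.

Let patch u (Du : D u) := patch_divergence D_open (d1 Xs) (d1 (smooth_on_pderiv 0 Xs))
  (d2 Xs) (d1 Ns) (d1 (smooth_on_pderiv 0 Ns)) (d2 Ns)
  (fun v Dv => conj (ds 0 Dv) (ds 1 Dv)) (fun v Dv => conj (dH 0 Dv) (dH 1 Dv))
  XX NN NX (NXi 0) (NXi 1) det_gram_gt0 H_mean (H_grad 0) (H_grad 1) dot_s_N Du.

Let laplacianE u F1 F2 : D u ->
  is_derive u (delta_mx 0 0)
    (fun v => (dot (pderiv 1 X v) (pderiv 1 X v) * pderiv 0 H v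
               - dot (pderiv 0 X v) (pderiv 1 X v) * pderiv 1 H v)
      / Num.sqrt (dot (pderiv 0 X v) (pderiv 0 X v) * dot (pderiv 1 X v) (pderiv 1 X v)
                  - dot (pderiv 0 X v) (pderiv 1 X v) ^+ 2)) F1 ->
  is_derive u (delta_mx 0 1)
    (fun v => (dot (pderiv 0 X v) (pderiv 0 X v) * pderiv 1 H v
               - dot (pderiv 0 X v) (pderiv 1 X v) * pderiv 0 H v)
      / Num.sqrt (dot (pderiv 0 X v) (pderiv 0 X v) * dot (pderiv 1 X v) (pderiv 1 X v)
                  - dot (pderiv 0 X v) (pderiv 1 X v) ^+ 2)) F2 ->
  laplacian x (mean_curvature A x n) c u = (Num.sqrt (\det (g u)))^-1 * (F1 + F2).
Proof.
move=> Du dF1 dF2; rewrite /laplacian sum_ord2; congr (_ * (_ + _)).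
  apply: (derive_val (is_derive := is_derive_on D_open Du _ dF1)) => v Dv.
  rewrite sum_ord2; apply/esym.
  exact: (@gram_sqrt_det _ (fun i => pderiv i X v) _ _ (det_gt0 Dv)).1.
apply: (derive_val (is_derive := is_derive_on D_open Du _ dF2)) => v Dv.
rewrite sum_ord2; apply/esym.
exact: (@gram_sqrt_det _ (fun i => pderiv i X v) _ _ (det_gt0 Dv)).2.
Qed.

Let ys_time_pderiv i u : D u -> lsubmx (pderiv i Y u) 0 0 =
  dot (rsubmx (pderiv i Y u)) (X u) + dot (s u) (pderiv i X u).
Proof.
move=> Du; have dtime : is_derive u (delta_mx 0 i) (fun v => lsubmx (Y v) 0 0)
    (lsubmx (pderiv i Y u) 0 0).
  exact: (is_derive_mxP _ _ _ _).1 (is_derive_lsubmx (smooth_on_is_derive i Ys Du)) 0 0.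
have dE := is_derive_unique_on D_open Du ys_time dtime (is_deriveD (is_derive_cst _ _ _)
  (is_derive_dot (ds i Du) (smooth_on_is_derive i Xs Du))).
exact: etrans dE (add0r _).
Qed.

Lemma mink_pderiv_dual u i j : D u ->
  mink (pderiv i Y u) (pderiv j xi u) =
  dot (rsubmx (pderiv i Y u)) (H u *: pderiv j X u + pderiv j N u)
  - dot (s u) (pderiv i X u) * pderiv j H u.
Proof.
move=> Du; have -> : pderiv j xi u = _ :=
  derive_val (is_derive := pderiv_conformal_gauss j Du).
have -> : mink (pderiv i Y u) _ = _ := mink_scalar_row _ _ _.
rewrite (ys_time_pderiv i Du).
rewrite dotDr dotZr; move: (dot _ (_ + _)) => z.
by rewrite mulrDl opprD (mulrC _ (pderiv j H u)); ring.
Qed.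

Lemma willmore_trace u : D u ->
  laplacian x (mean_curvature A x n) c u
  + tensor_normsq (g u) (tracefree_second_form A x n c u) * H u =
  \tr (invmx (g u) *m B u).
Proof.
move=> Du; have [F1 [F2 [dF1 dF2 FE]]] := patch Du.
rewrite (laplacianE Du dF1 dF2) /tracefree_second_form -/(h u).
rewrite -[mean_curvature _ _ _ _]/(H u).
have BE : B u = \matrix_(i, j) (dot (rsubmx (pderiv i Y u))
    (H u *: pderiv j X u + pderiv j N u) - dot (s u) (pderiv i X u) * pderiv j H u).
  by apply/matrixP => i j; rewrite !mxE mink_pderiv_dual.
rewrite BE; exact: (@gram_trace _ (fun i => pderiv i X u) (fun i => pderiv i N u)
   (H u) (g_unit Du) (sym Du) (trK Du) (fun i => rsubmx (pderiv i Y u)) (s u)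
   (fun i => pderiv i H u) _ FE).
Qed.

Let NiX i u : D u -> dot (pderiv i N u) (X u) = 0.
Proof.
move=> Du; have := dot_derive_const D_open Du (smooth_on_is_derive i Ns Du)
  (smooth_on_is_derive i Xs Du) NX.
by rewrite NXi// oppr0.
Qed.

Let NiN i u : D u -> dot (pderiv i N u) (N u) = 0.
Proof.
by move=> Du; exact: (dot_derive_self D_open Du (smooth_on_is_derive i Ns Du) NN).
Qed.

Let XiX i u : D u -> dot (pderiv i X u) (X u) = 0.
Proof.
by move=> Du; exact: (dot_derive_self D_open Du (smooth_on_is_derive i Xs Du) XX).
Qed.

Let frame u : D u -> is_frame (X u) (N u) (pderiv 0 X u) (pderiv 1 X u).
Proof.
by move=> Du; exact: (patch_frame D_open (d1 Xs) XX NN NX (NXi 0) (NXi 1)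
  det_gram_gt0 Du).
Qed.

Let s_null u : D u -> dot (s u) (s u) = (1 + dot (s u) (X u)) ^+ 2.
Proof.
move=> Du; case: ys_dual => _ /(_ (param c u)) [+ _] _ _ _.
rewrite /mink -[ys _]/(Y u) ys_time// -/(s u) => E.
by apply/eqP; rewrite -subr_eq0; apply/eqP; rewrite -E; ring.
Qed.

Let s_null_pderiv i u : D u -> dot (rsubmx (pderiv i Y u)) (s u) =
  (dot (rsubmx (pderiv i Y u)) (X u) + dot (s u) (pderiv i X u))
  * (1 + dot (s u) (X u)).
Proof.
move=> Du; have c1 : is_derive u (delta_mx 0 i) (fun=> 1 : R) 0 := is_derive_cst _ _ _.
have c2 : is_derive u (delta_mx 0 i) (fun v => 1 + dot (s v) (X v)) (0 +
    (dot (rsubmx (pderiv i Y u)) (X u) + dot (s u) (pderiv i X u))).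
  exact: is_deriveD c1 (is_derive_dot (ds i Du) (smooth_on_is_derive i Xs Du)).
have := is_derive_unique_on D_open Du s_null (is_derive_dot (ds i Du) (ds i Du))
  (is_derive_sqr_fun c2).
rewrite (dotC (s u) (rsubmx _)); move: (dot _ (X u) + _) (1 + _) (dot _ (s u)) => r q p.
by rewrite add0r; lra.
Qed.

Let s_N_pderiv i u : D u ->
  dot (rsubmx (pderiv i Y u)) (N u) = H u * dot (s u) (pderiv i X u).
Proof.
move=> Du; have := is_derive_unique_on D_open Du dot_s_N
  (is_derive_dot (ds i Du) (smooth_on_is_derive i Ns Du)) (dH i Du).
by rewrite (H_grad i Du) dotDr dotZr => /addIr.
Qed.

Let Dual u : 'M[R]_2 := dual_mx (s u) (fun i => pderiv i X u)
  (fun i => rsubmx (pderiv i Y u)).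

Let mink_pderiv_pderiv u i j : D u -> mink (pderiv i Y u) (pderiv j Y u) =
  (Dual u *m invmx (g u) *m (Dual u)^T) i j.
Proof.
move=> Du; apply: etrans (congr2 (fun p q => - (p * q) + _) (ys_time_pderiv i Du)
  (ys_time_pderiv j Du)) _.
exact: (@dual_metric _ (X u) (N u) (s u) (fun i => pderiv i X u)
  (fun i => rsubmx (pderiv i Y u)) (H u) (frame Du) (dot_s_N Du)
  (fun i => s_N_pderiv i Du) (s_null Du) (fun i => s_null_pderiv i Du)).
Qed.

Let BE u : D u -> B u =
  - (Dual u *m invmx (g u) *m (h u - H u *: g u)).
Proof.
move=> Du; apply/matrixP => i j; rewrite mxE mink_pderiv_dual// H_grad// mxE.
exact: (@dual_second _ (X u) (N u) (s u) (fun i => pderiv i X u)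
  (fun i => pderiv i N u) (fun i => rsubmx (pderiv i Y u)) (H u) (frame Du)
  (fun i => NiX i Du) (fun i => NiN i Du)).
Qed.

(** * Fundamental forms and mean curvature of the ruled surface *)

Let lift := light_lift x \o param c.
Let f := ruled_surface x ys.
Let nu := fun tp : R * M => conformal_gauss A x n tp.2.
Let dX i u : 'rV[R]_(1 + 4) := row_mx 0%:M (pderiv i X u).

Let lift_pderiv i u : D u -> is_derive u (delta_mx 0 i) lift (dX i u).
Proof.
move=> Du; apply: is_derive_row_mx (smooth_on_is_derive i Xs Du).
rewrite (_ : 0%:M = 0); first exact: is_derive_cst.
by apply/matrixP => a b; rewrite !mxE mul0rn.
Qed.

Let ruled_chart := fun t u => (Num.sqrt 2)^-1 *: (expR t *: lift u + expR (- t) *: Y u).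

Let pderiv_ruled_time w : pderiv (lshift 2 0) (f \o prod_param c) w =
  ruled_time (expR (lsubmx w 0 0)) (lift (rsubmx w)) (Y (rsubmx w)).
Proof.
set t := lsubmx w 0 0; set u := rsubmx w.
have de : is_derive t 1 (fun t => expR (- t) : R) (- (expR t)^-1).
  apply: is_derive_eq (is_derive1_comp (is_derive_expR (- t)) (is_deriveNid t 1)) _.
  by rewrite expRN -[RHS]mulrN1.
have : is_derive t 1 (ruled_chart ^~ u) ((Num.sqrt 2)^-1 *:
   ((expR t *: lift u + expR t *: 0) + (- (expR t)^-1 *: Y u + expR (- t) *: 0))).
  apply: is_deriveZ; apply: is_deriveD; apply: is_derive_scale => //;
    exact: is_derive_cst.
rewrite !scaler0 !addr0 => /(is_derive_time (F := ruled_chart))[_]; exact.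
Qed.

Let pderiv_ruled_space i w : D (rsubmx w) ->
  pderiv (rshift 1 i) (f \o prod_param c) w =
  ruled_space (expR (lsubmx w 0 0)) (dX i (rsubmx w)) (pderiv i Y (rsubmx w)).
Proof.
set t := lsubmx w 0 0; set u := rsubmx w => Du.
have : is_derive u (delta_mx 0 i) (ruled_chart t) ((Num.sqrt 2)^-1 *:
   (expR t *: dX i u + expR (- t) *: pderiv i Y u)).
  by apply: is_deriveZ; apply: is_deriveD; apply: is_deriveZ;
    [exact: lift_pderiv|exact: smooth_on_is_derive Ys Du].
rewrite expRN => /(is_derive_space (F := ruled_chart))[_]; exact.
Qed.

Let pderiv_normal_time w : pderiv (lshift 2 0) (nu \o prod_param c) w = 0.
Proof.
have : is_derive (lsubmx w 0 0) 1 ((fun _ => xi) ^~ (rsubmx w)) 0 :=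
  is_derive_cst _ _ _.
by move=> /(is_derive_time (F := fun _ => xi))[_]; exact.
Qed.

Let pderiv_normal_space i w : D (rsubmx w) ->
  pderiv (rshift 1 i) (nu \o prod_param c) w = pderiv i xi (rsubmx w).
Proof.
move=> Du; have [dxi _] := pderiv_conformal_gauss i Du.
have : is_derive (rsubmx w) (delta_mx 0 i) xi (pderiv i xi (rsubmx w)) by split.
by move=> /(is_derive_space (F := fun _ => xi))[_]; exact.
Qed.

Let lift_null u : D u -> mink (lift u) (lift u) = 0.
Proof.
by move=> Du; rewrite mink_row -[x _]/(X u) XX// !mxE mulr1 addNr.
Qed.

Let Y_null u : mink (Y u) (Y u) = 0.
Proof. by case: ys_dual => _ /(_ (param c u)) [] + _ _ _ _. Qed.

Let Y_lift u : mink (Y u) (lift u) = - 1.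
Proof. by case: ys_dual => _ _ /(_ (param c u)) + _ _. Qed.

Let lift_dX i u : D u -> mink (lift u) (dX i u) = 0.
Proof.
by move=> Du; rewrite mink_row -[x _]/(X u) dotC XiX// !mxE mul0rn mulr0 oppr0 addr0.
Qed.

Let mink_dX v i u : mink v (dX i u) = dot (rsubmx v) (pderiv i X u).
Proof. by rewrite mink_scalar_row mulr0 oppr0 add0r. Qed.

Let Y_pderiv i u : D u -> mink (Y u) (pderiv i Y u) = 0.
Proof.
move=> Du; rewrite minkC /mink (ys_time_pderiv i Du) (ys_time Du).
have -> : dot _ (rsubmx (Y u)) = _ := s_null_pderiv i Du.
by rewrite addNr.
Qed.

Let pderiv_Y_lift i u : D u ->
  mink (pderiv i Y u) (lift u) = - dot (s u) (pderiv i X u).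
Proof.
move=> Du; rewrite mink_scalar_row (ys_time_pderiv i Du) -[x _]/(X u) mulr1.
by rewrite opprD addrAC addNr add0r.
Qed.

Let lift_xi j u : D u -> mink (lift u) (pderiv j xi u) = 0.
Proof.
move=> Du; have -> : pderiv j xi u = _ :=
  derive_val (is_derive := pderiv_conformal_gauss j Du).
rewrite mink_row -[x _]/(X u) !dotDr !dotZr XX// (dotC (X u)) XiX// (dotC (X u)) NiX//.
by rewrite mulr0 !addr0 !mxE !eqxx !mulr1n mul1r mulr1 addNr.
Qed.

Let Y_xi j u : D u -> mink (Y u) (pderiv j xi u) = 0.
Proof. by move=> Du; case: ys_dual => _ _ _ _ /(_ c u j cA Du). Qed.

Let dX_xi i j u : D u -> mink (dX i u) (pderiv j xi u) = - (h u - H u *: g u) i j.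
Proof.
move=> Du; have -> : pderiv j xi u = _ :=
  derive_val (is_derive := pderiv_conformal_gauss j Du).
have : dot (pderiv i X u) (X u) = 0 := XiX i Du.
have -> : (h u - H u *: g u) i j = - dot (pderiv i X u) (pderiv j N u)
    - H u * dot (pderiv i X u) (pderiv j X u) by rewrite !mxE.
have z00 : (0%:M : 'M[R]_1) 0 0 = 0 by rewrite mxE mul0rn.
rewrite mink_row z00.
move: (pderiv i X u) (pderiv j X u) (pderiv j N u) (X u) => p q r v pv.
by rewrite !dotDr !dotZr pv; move: (H u) (pderiv j H u) (dot _ _) => ? ? ?; ring.
Qed.

Let wrow u : 'rV[R]_2 := \row_i - dot (s u) (pderiv i X u).

(** The t-direction is a unit vector, and its products with d_i x^+ are - <y*, d_i y>, free of t.
    The last block is displayed as Schur complement plus outer product. *)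
Let ruled_first w : D (rsubmx w) ->
  let u := rsubmx w in let k := expR (lsubmx w 0 0) in
  first_form3 f c w = block_mx 1%:M (wrow u) (wrow u)^T
    (2^-1 *: (k ^+ 2 *: g u + (Dual u + (Dual u)^T)
              + k ^- 2 *: (Dual u *m invmx (g u) *m (Dual u)^T))
     + (wrow u)^T *m wrow u).
Proof.
move=> Du u k; have k0 : k != 0 by rewrite gt_eqF// expR_gt0.
have TS j : mink (ruled_time k (lift u) (Y u)) (ruled_space k (dX j u) (pderiv j Y u)) =
    - dot (s u) (pderiv j X u).
  exact: (mink_ruled_time_space k0 (lift_dX j Du) (Y_pderiv j Du) (mink_dX _ _ _)
    (pderiv_Y_lift j Du)).
have wE j : wrow u 0 j = - dot (s u) (pderiv j X u) by rewrite mxE.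
have wTE j : (wrow u)^T j 0 = - dot (s u) (pderiv j X u) by rewrite !mxE.
have dt := pderiv_ruled_time w; have dsp i := pderiv_ruled_space i Du.
apply: block_mx_entries => [|j|i|i j]; apply: etrans (mxE _ _ _ _) _.
- apply: etrans (congr2 mink dt dt) _; apply: etrans (esym (mxE _ _ _ _)); rewrite eqxx.
  exact: (mink_ruled_time k0 (lift_null Du) (Y_null u) (Y_lift u)).
- exact: etrans (congr2 mink dt (dsp j)) (etrans (TS j) (esym (wE j))).
- apply: etrans (congr2 mink (dsp i) dt) _; apply: etrans (minkC _ _) _.
  exact: etrans (TS i) (esym (wTE i)).
apply: etrans (congr2 mink (dsp i) (dsp j)) _; rewrite mink_ruled_space//.
apply: etrans (esym (mx_quadratic_entries _ _ _ _ _ _ _ _ _)).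
have gX : mink (dX i u) (dX j u) = g u i j by rewrite mink_dX /dX row_mxKr mxE.
have DE i' j' : Dual u i' j' = mink (pderiv i' Y u) (dX j' u)
    - dot (s u) (pderiv i' X u) * dot (s u) (pderiv j' X u).
  by rewrite mink_dX mxE.
exact: (complete_square _ _ gX (mink_pderiv_pderiv i j Du) (DE i j) (DE j i) (wE i)
  (wE j)).
Qed.

(** The normal xi is constant along the rulings, and y and y* are orthogonal to d_j xi; hence the
    row and the column of t vanish. *)
Let ruled_second w : D (rsubmx w) ->
  let u := rsubmx w in let k := expR (lsubmx w 0 0) in
  let T := h u - H u *: g u in
  second_form3 f nu c w = block_mx 0 0 0
    ((Num.sqrt 2)^-1 *: (k *: T + k^-1 *: (Dual u *m invmx (g u) *m T))).
Proof.
move=> Du u k T.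
have dt := pderiv_ruled_time w; have dsp i := pderiv_ruled_space i Du.
have nt := pderiv_normal_time w; have nsp i := pderiv_normal_space i Du.
have mink0 v : mink v 0 = 0 by rewrite -[0 in LHS](scale0r 0) minkZr mul0r.
apply: block_mx_entries => [|j|i|i j]; apply: etrans (mxE _ _ _ _) _.
- apply: etrans (congr2 (fun a b => - mink a b) dt nt) _.
  by rewrite mink0 oppr0 mxE.
- apply: etrans (congr2 (fun a b => - mink a b) dt (nsp j)) _.
  apply: etrans (congr1 -%R (mink_ruled_time_normal _ (lift_xi j Du) (Y_xi j Du))) _.
  by rewrite oppr0 mxE.
- apply: etrans (congr2 (fun a b => - mink a b) (dsp i) nt) _.
  by rewrite mink0 oppr0 mxE.
apply: etrans (congr2 (fun a b => - mink a b) (dsp i) (nsp j)) _.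
rewrite mink_ruled_space_normal (dX_xi i j Du) opprK.
have -> : mink (pderiv i Y u) (pderiv j xi u) = B u i j by rewrite mxE.
rewrite (BE Du).
have fin (T' Z' : 'M[R]_2) r a e :
    r * (a * T' i j + e * - (- Z') i j) = (r *: (a *: T' + e *: Z')) i j.
  by rewrite !mxE opprK.
exact: fin.
Qed.

Let T_sym u : D u -> (h u - H u *: g u)^T = h u - H u *: g u.
Proof.
move=> Du; have hT : (h u)^T = h u.
  exact: (@shape_mx_sym _ (fun i => pderiv i X u) (fun i => pderiv i N u) (sym Du)).
by rewrite linearB linearZ /= hT first_form_sym.
Qed.

Let T_tracefree u : D u -> \tr (invmx (g u) *m (h u - H u *: g u)) = 0.
Proof.
move=> Du; rewrite mulmxBr -scalemxAr (mulVmx (g_unit Du)).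
rewrite [LHS]linearB /= mxtraceZ mxtrace1 (trK Du).
by rewrite mulrC subrr.
Qed.

Let ruled_det t u := \det ((expR t)%:M + (expR t)^-1 *: (Dual u *m invmx (g u))).

Lemma ruled_surface_unit w : D (rsubmx w) ->
  (first_form3 f c w \in unitmx) = (ruled_det (lsubmx w 0 0) (rsubmx w) != 0).
Proof.
move=> Du; rewrite (ruled_first Du) unitmx_block_schur addrK.
exact: (ruled_metric_unit _ (expR_gt0 _) (g_unit Du) (first_form_sym _ _ _)).
Qed.

Lemma ruled_surface_trace w : D (rsubmx w) -> first_form3 f c w \in unitmx ->
  \tr (invmx (first_form3 f c w) *m second_form3 f nu c w) =
  Num.sqrt 2 / (expR (lsubmx w 0 0) * ruled_det (lsubmx w 0 0) (rsubmx w)) *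
  \tr (invmx (g (rsubmx w)) *m B (rsubmx w)).
Proof.
move=> Du; rewrite (ruled_first Du) (ruled_second Du) => Iu.
have Su := Iu; rewrite unitmx_block_schur addrK in Su.
rewrite tr_block_schur -?unitmx_block_schur// addrK.
apply: etrans (ruled_trace (expR_gt0 _) (g_unit Du) (first_form_sym _ _ _) (T_sym Du)
  (T_tracefree Du) Su) _.
rewrite (BE Du) mulmxN [in RHS]raddfN mulrN; congr (- (_ * \tr _)).
by rewrite !mulmxA.
Qed.

End LocalGeometry.

(** * Equivalence of the two curvature conditions, point by point *)

Theorem theorem3p4p1 (R : realType) (M : topologicalType)
    (M_hausdorff : hausdorff_space M) (M_countable : @second_countable M)
    (A : smooth_atlas R M) (x n : M -> 'rV[R]_4)
    (x_immersed : immersed_in_S3 A x) (n_normal : unit_normal A x n)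
    (no_umbilical : forall p, ~ umbilical A x n p)
    (ys : M -> 'rV[R]_(1 + 4)) (ys_dual : dual_light_lift A x n ys) :
  willmore A x n <->
  minimal3 A (ruled_surface x ys)
             (fun tp : R * M => conformal_gauss A x n tp.2).
Proof.
split=> [W c w cA Du wu|m c u cA Du].
  rewrite (ruled_surface_trace x_immersed n_normal ys_dual cA Du wu).
  rewrite -(willmore_trace x_immersed n_normal ys_dual cA Du).
  by rewrite [X in _ * X](W c _ cA Du) mulr0.
apply: etrans (willmore_trace x_immersed n_normal ys_dual cA Du) _.
pose P := dual_mx (rsubmx (ys (param c u))) (fun i => pderiv i (x \o param c) u)
  (fun i => rsubmx (pderiv i (ys \o param c) u)).
(* Minimality gives information only where the metric is nondegenerate, so the ruling over u is
   followed to a parameter t where the determinant does not vanish; one such t already forces the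
   trace at u to be zero. *)
have [t t0] := exists_det_neq0 (P *m invmx (first_form x c u)).
pose w : 'rV[R]_(1 + 2) := row_mx t%:M u.
have wt : lsubmx w 0 0 = t by rewrite row_mxKl mxE eqxx.
have wu : rsubmx w = u by rewrite row_mxKr.
have Dw : cimg c (rsubmx w) by rewrite wu.
have Iu : first_form3 (ruled_surface x ys) c w \in unitmx.
  by rewrite (ruled_surface_unit x_immersed n_normal ys_dual cA Dw) wt wu.
have := m c w cA Dw Iu.
rewrite (ruled_surface_trace x_immersed n_normal ys_dual cA Dw Iu) wt wu.
move/eqP; rewrite mulf_eq0 => /orP[|/eqP //].
by rewrite mulf_eq0 invr_eq0 mulf_eq0 (negbTE t0) orbF !gt_eqF ?expR_gt0 ?sqrtr_gt0//.
Qed.
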